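(* Let $(\Omega,\mathcal F,\mathbb P)$ be an atomless probability space. A bivariate copula $C\in\mathcal C_2$ belongs to some bivariate concentration class if and only if $C\in\mathcal D_p$ for some $p\in(0,1)$, where $\mathcal D_p=\{C\in\mathcal C_2: C(p,p)=p\}$.
   Context: $(\Omega,\mathcal F,\mathbb P)$ is an atomless probability space; $L^\infty_c$ is the set of essentially bounded random variables on it with continuous distribution. $\mathcal C_2$ is the set of bivariate copulas (joint distribution functions with standard uniform marginals). For random variables with continuous distributions the copula of a pair is unique. For copulas, $C\le C'$ means pointwise inequality of functions. For $C\in\mathcal C_2$, a sequence $(X_n)_{n\in\mathbb N}$ of random variables in $L^\infty_c$ is sequentially $C$-coupled if $X_n\overset{d}{=}X_{n+1}$ (equality in law) and $C$ is the copula of $(X_n,X_{n+1})$ for each $n\in\mathbb N$ (the dependence between $X_n$ and $X_k$ with $|n-k|>1$ is unspecified). $C$ is non-diversifiable if for every sequentially $C$-coupled sequence $(X_n)_{n\in\mathbb N}$ in $L^\infty_c$, the averages $\frac1n\sum_{i=1}^nX_i-\mathbb E[X_1]$ do not converge to $0$ in probability as $n\to\infty$. A bivariate concentration class is a subset $\mathcal D\subseteq\mathcal C_2$ satisfying: [ND] each $C\in\mathcal D$ is non-diversifiable; [DM] if $C\in\mathcal D$, $C'\in\mathcal C_2$ and $C\le C'$, then $C'\in\mathcal D$; [Cx] if $C_n\in\mathcal D$ for all $n\in\mathbb N$, then $\sum_{n\in\mathbb N}\lambda_nC_n\in\mathcal D$ for all $\lambda_n\ge0$ with $\sum_{n\in\mathbb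 N}\lambda_n=1$. *)

(* Defs.v *)
(* MathComp-Analysis *)
From HB Require Import structures.
From mathcomp Require Import all_boot all_order all_algebra.
From mathcomp Require Import all_classical all_reals all_analysis.

Set Implicit Arguments.
Unset Strict Implicit.
Unset Printing Implicit Defensive.

Import Order.TTheory GRing.Theory Num.Theory.
Import numFieldNormedType.Exports.

Local Open Scope classical_set_scope.
Local Open Scope ring_scope.

Definition atomless d (T : measurableType d) (R : realType)
    (P : probability T R) : Prop :=
  forall A : set T, measurable A -> (0 < P A)%E ->
    exists B : set T,
      [/\ measurable B, B `<=` A, (0 < P B)%E & (P B < P A)%E].

Section Copulas.
Variable R : realType.

(* A copula is the joint distribution function, on all of R^2, of a Borel
   probability measure with standard uniform marginals; its values on R^2 are
   determined by those on [0, 1]^2.  The marginals are compared on measurable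
   sets only, since a measure carries junk values outside its sigma-algebra. *)
Definition copula (C : R -> R -> R) : Prop :=
  exists mu : probability (R * R)%type R,
    [/\ forall A : set R, measurable A ->
          pushforward mu fst A = uniform_prob (@ltr01 R) A,
        forall A : set R, measurable A ->
          pushforward mu snd A = uniform_prob (@ltr01 R) A
      & forall u v : R, mu (`]-oo, u] `*` `]-oo, v]) = (C u v)%:E].

Definition copula_le (C C' : R -> R -> R) : Prop :=
  forall u v : R, C u v <= C' u v.

Definition copula_series (lambda : nat -> R) (C : nat -> R -> R -> R) :
    R -> R -> R :=
  fun u v => limn (series (fun n => lambda n * C n u v)).

Definition diagonal_class (p : R) : set (R -> R -> R) :=
  [set C | copula C /\ C p p = p].

End Copulas.

Section Diversification.
Context d (T : measurableType d) (R : realType) (P : probability T R).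

Definition in_Linfty_c (X : {RV P >-> R}) : Prop :=
  (X : T -> R) \in Lfun P +oo%E /\ continuous (@cdf d T R P X).

Definition eq_in_law (X Y : {RV P >-> R}) : Prop :=
  forall A : set R, measurable A -> distribution P X A = distribution P Y A.

Definition is_copula_of (C : R -> R -> R) (X Y : {RV P >-> R}) : Prop :=
  copula C /\
  forall x y : R,
    P (X @^-1` `]-oo, x] `&` Y @^-1` `]-oo, y]) =
    (C (fine (@cdf d T R P X x)) (fine (@cdf d T R P Y y)))%:E.

Definition seq_coupled (C : R -> R -> R) (X : nat -> {RV P >-> R}) : Prop :=
  (forall n, in_Linfty_c (X n)) /\
  (forall n, eq_in_law (X n) (X n.+1) /\ is_copula_of C (X n) (X n.+1)).

Definition cvg_in_probability (Y : nat -> T -> R) (c : R) : Prop :=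
  forall e : R, 0 < e ->
    P [set w | e < `|Y n w - c|] @[n --> \oo] --> 0%E.

(* Sequences are indexed from 0, so the n-th term is the average of the first
   n + 1 variables. *)
Definition centered_average (X : nat -> {RV P >-> R}) (n : nat) (w : T) : R :=
  n.+1%:R^-1 * (\sum_(i < n.+1) X i w) - fine 'E_P[X 0%N].

Definition non_diversifiable (C : R -> R -> R) : Prop :=
  forall X : nat -> {RV P >-> R},
    seq_coupled C X -> ~ cvg_in_probability (centered_average X) 0.

Record concentration_class (D : set (R -> R -> R)) : Prop := {
  concentration_copula : forall C, D C -> copula C ;
  concentration_ND : forall C, D C -> non_diversifiable C ;
  concentration_DM : forall C C', D C -> copula C' -> copula_le C C' -> D C' ;
  concentration_Cx : forall (C : nat -> R -> R -> R) (lambda : nat -> R),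
    (forall n, D (C n)) -> (forall n, 0 <= lambda n) ->
    series lambda @ \oo --> (1 : R) -> D (copula_series lambda C)
}.

End Diversification.

(* Main.v *)
(* If C(p,p) = p, the events {X_n <= q}, with q a p-quantile of the common law,
   coincide almost surely, so the averages keep a trace of X_1; moreover the
   condition C(p,p) = p is stable under domination and mixtures.

   Conversely, suppose C(p,p) < p for all p in (0,1); it suffices to dominate C
   by a diversifiable copula.  Pick a random index k once and for all, and let
   X_n run back and forth, with a uniform phase and period 2 M_k, over the
   interval [a_k, 1 - a_k], where a_k decreases to 0.  As X_(n + M_k) = 1 - X_n,
   the averages tend to 1/2 on every path.  The law F of X_n does not depend on
   the periods, and X_(n+1) - X_n is at most 1 / M_k on the loop k.  The pair
   (X_n, X_(n+1)) can have C'(F x, F y) < min (F x, F y) only if some loop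
   crosses from one side of x and y to the other in one step; since
   C(F w, F w) < F w, on each [a_k, 1 - a_k] this defect is smaller than that
   of C once M_k is large. *)
Require Import Defs.
From HB Require Import structures.
From mathcomp Require Import all_boot all_order all_algebra.
From mathcomp Require Import all_classical all_reals all_analysis.
From mathcomp Require Import measurable_realfun ess_sup_inf unstable.
From mathcomp Require Import ring lra.

Set Implicit Arguments.
Unset Strict Implicit.
Unset Printing Implicit Defensive.

Import Order.TTheory GRing.Theory Num.Theory.
Import numFieldNormedType.Exports.

Local Open Scope classical_set_scope.
Local Open Scope ring_scope.

(** * Probabilities as real numbers *)

(** The defect [p - C p p] vanishes at both ends of []0, 1[], so no single step size can be
    controlled by it everywhere; compactness gives one only on each [[a_k, 1 - a_k]]. Hence a family
    of loops: points close to 0 or 1 are visited only by loops of large index, whose steps are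
    small. The ends [a_k] tend to 0 so that [F] stays strictly between 0 and 1 on []0, 1[], where
    the hypothesis on [C] applies. The choice of periods is not circular: [F] is fixed first, and
    the periods are then read off from [C] and [F]. Index and phase both come from one uniform
    variable [U], which atomlessness provides: the index is the number of the dyadic block
    [[2^-(k+1), 2^-k[] that contains [U], the phase is the position of [U] in that block. Rotating
    every block preserves the law of [U], which makes all consecutive pairs share one copula. *)

Section RealProbability.
Context d (T : measurableType d) (R : realType) (P : probability T R).
Implicit Types A B : set T.

Definition pr A : R := fine (P A).

Lemma prE A : measurable A -> P A = (pr A)%:E.
Proof. by move=> mA; rewrite /pr fineK// fin_num_measure. Qed.

Lemma pr_ge0 A : 0 <= pr A.
Proof. exact: fine_ge0. Qed.

Lemma pr0 : pr set0 = 0.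
Proof. by rewrite /pr measure0. Qed.

Lemma prT : pr setT = 1.
Proof. by rewrite /pr probability_setT. Qed.

Lemma le_pr A B : measurable A -> measurable B -> A `<=` B -> pr A <= pr B.
Proof.
by move=> mA mB AB; rewrite -lee_fin -!prE// le_measure// inE.
Qed.

Lemma pr_le1 A : measurable A -> pr A <= 1.
Proof. by move=> mA; rewrite -lee_fin -prE// probability_le1. Qed.

Lemma prU A B : measurable A -> measurable B -> [disjoint A & B] ->
  pr (A `|` B) = pr A + pr B.
Proof.
move=> mA mB /eqP AB; apply: EFin_inj.
by rewrite EFinD -!prE ?measureU//; exact: measurableU.
Qed.

Lemma prDI A B : measurable A -> measurable B ->
  pr A = pr (A `\` B) + pr (A `&` B).
Proof.
move=> mA mB; apply: EFin_inj; rewrite EFinD -!prE ?(measureDI P mA mB)//.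
  exact: measurableI.
exact: measurableD.
Qed.

Lemma prDs A B : measurable A -> measurable B -> B `<=` A ->
  pr (A `\` B) = pr A - pr B.
Proof. by move=> mA mB BA; rewrite (prDI mA mB) (setIidr BA) addrK. Qed.

Lemma pr_null A : measurable A -> pr A = 0 -> P A = 0%E.
Proof. by move=> mA A0; rewrite prE// A0. Qed.

Lemma pr_setI_full A B : measurable A -> measurable B ->
  pr (~` B) = 0 -> pr (A `&` B) = pr A.
Proof.
move=> mA mB B0; rewrite (prDI mA mB) -[LHS]add0r; congr (_ + _).
apply/eqP; rewrite eq_le pr_ge0/= -[leRHS]B0.
apply: le_pr; [exact: measurableD|exact: measurableC|].
by move=> x [].
Qed.

End RealProbability.

Lemma measurable_set_le d (T : measurableType d) (R : realType) (f : T -> R)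
  (x : R) : measurable_fun setT f -> measurable [set w | f w <= x].
Proof.
move=> mf; rewrite -[X in measurable X]setTI.
rewrite [X in _ `&` X](_ : _ = f @^-1` `]-oo, x]); last first.
  by apply/seteqP; split => w /=; rewrite in_itv.
exact: mf.
Qed.

Lemma measurable_set_lt d (T : measurableType d) (R : realType) (f : T -> R)
  (x : R) : measurable_fun setT f -> measurable [set w | f w < x].
Proof.
move=> mf; rewrite -[X in measurable X]setTI.
rewrite [X in _ `&` X](_ : _ = f @^-1` `]-oo, x[); last first.
  by apply/seteqP; split => w /=; rewrite in_itv.
exact: mf.
Qed.

(** The rays []x, +oo[] are stable under intersection and generate the Borel sets; their masses are
    complementary to those in the hypothesis. *)
Lemma measure_eq_cdf (R : realType) (m1 m2 : probability R R) :
  (forall x : R, m1 `]-oo, x]%classic = m2 `]-oo, x]%classic) ->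
  forall A, measurable A -> m1 A = m2 A.
Proof.
move=> m12 A.
pose g (n : nat) : set R := `]- n%:R, +oo[%classic.
apply: (measure_unique (@RGenOInfty.G R) g).
- exact: RGenOInfty.measurableE.
- move=> _ _ [x ->] [y ->]; exists (Num.max x y).
  by apply/seteqP; split => z /=; rewrite !in_itv/= !andbT gt_max => /andP.
- by move=> i; eexists.
- rewrite -subTset => x _; exists (Num.bound x) => //=.
  by rewrite /g/= in_itv/= andbT ltrNl ltrNbound.
- move=> _ [x ->]; rewrite -setCitvl.
  by rewrite [LHS]probability_setC// [RHS]probability_setC// m12.
- move=> k; rewrite (le_lt_trans (probability_le1 _ _)) ?ltry//.
  exact: measurable_itv.
Qed.

(** * A uniform variable on an atomless space *)

Section Sierpinski.
Context d (T : measurableType d) (R : realType) (P : probability T R).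
Hypothesis hP : atomless P.
Local Notation pr := (pr P).

(** Take a part [B] of strictly intermediate mass: either [B] or its complement in [A] has at most
    half of the mass. *)
Lemma atomless_halve (A : set T) : measurable A -> 0 < pr A ->
  exists B, [/\ measurable B, B `<=` A, 0 < pr B & pr B <= pr A / 2].
Proof.
move=> mA A0.
have [|B [mB BA B0 BltA]] := hP mA; first by rewrite prE// lte_fin.
move: B0 BltA; rewrite !prE// !lte_fin => B0 BltA.
have [BA2|BA2] := leP (pr B) (pr A / 2); first by exists B.
exists (A `\` B); split => //; first exact: measurableD.
- by rewrite prDs// subr_gt0.
- rewrite prDs//; lra.
Qed.

Lemma atomless_small (A : set T) (e : R) : measurable A -> 0 < pr A -> 0 < e ->
  exists B, [/\ measurable B, B `<=` A, 0 < pr B & pr B < e].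
Proof.
move=> mA A0 e0.
have /(_ _)/cid H n : exists B, [/\ measurable B, B `<=` A, 0 < pr B &
    pr B <= 2^-1 ^+ n].
  elim: n => [|n [B [mB BA B0 Bn]]].
    by exists A; split => //; rewrite expr0; exact: pr_le1.
  have [B' [mB' B'B B'0 B'2]] := atomless_halve mB B0.
  exists B'; split => //; first exact: subset_trans BA.
  by rewrite exprSr (le_trans B'2)// ler_wpM2r.
pose n := Num.bound e^-1.
have [B [mB BA B0 Bn]] := H n.
exists B; split => //; apply: le_lt_trans Bn _.
rewrite exprVn -ltf_pV2 ?posrE ?invr_gt0 ?exprn_gt0// invrK.
by rewrite upper_nthrootP.
Qed.

(** Greedy exhaustion. Were the union of the stages to fall short of [t], a set [E] of positive mass
    below the deficit would be admissible at every stage; each stage then gains at least [pr E / 2],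
    and the mass would exceed 1. *)
Lemma atomless_between (A : set T) (t : R) : measurable A ->
  0 <= t <= pr A ->
  exists B, [/\ measurable B, B `<=` A & pr B = t].
Proof.
move=> mA /andP[t0 tA].
pose ok (S E : set T) := [/\ measurable E, E `<=` A `\` S & pr E <= t - pr S].
pose good (S : set T) := [/\ measurable S, S `<=` A & pr S <= t].
(* each step adds a set that is at least half as large as possible *)
have step (S : set T) : good S -> exists E, ok S E /\
    forall E', ok S E' -> pr E' <= 2 * pr E.
  move=> [mS SA St].
  pose V := [set pr E | E in [set E | ok S E]].
  have V0 : V 0.
    exists set0; last exact: pr0.
    by split => //; rewrite pr0 subr_ge0.
  have supV : has_sup V.
    split; first by exists 0.
    by exists 1 => _ [E [mE _ _] <-]; exact: pr_le1.
  have [s0|s0] := leP (sup V) 0.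
    exists set0; split; first by split => //; rewrite pr0 subr_ge0.
    move=> E' okE'; rewrite pr0 mulr0; apply: le_trans s0.
    by apply: ub_le_sup; [exact: supV.2|exists E'].
  have [|_ [E okE <-] sE] := @sup_adherent _ V (sup V / 2) _ supV.
    by rewrite divr_gt0.
  exists E; split => // E' okE'.
  have : pr E' <= sup V by apply: ub_le_sup; [exact: supV.2|exists E'].
  lra.
pose nxt (S : set T) : set T :=
  match pselect (good S) with
  | left g => projT1 (cid (step S g))
  | right _ => set0
  end.
pose F := fix F n := if n is m.+1 then F m `|` nxt (F m) else set0.
have nxtP S : good S -> ok S (nxt S) /\ forall E', ok S E' -> pr E' <=
  2 * pr (nxt S).
  move=> gS; rewrite /nxt; case: pselect => // g.
  by case: cid.
have goodF n : good (F n).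
  elim: n => [|n IH] /=; first by split => //; rewrite pr0.
  have [[mE EA Et] _] := nxtP _ IH.
  have [mS SA St] := IH.
  split; first exact: measurableU.
    by move=> x [/SA//|/EA[]].
  rewrite prU//; first by rewrite -lerBrDl.
  rewrite disj_set2E; apply/eqP/seteqP; split => // x [Sx /EA[]]//.
have FS n : pr (F n.+1) = pr (F n) + pr (nxt (F n)).
  have [[mE EA Et] _] := nxtP _ (goodF n).
  have [mS SA St] := goodF n.
  rewrite /= prU//.
  rewrite disj_set2E; apply/eqP/seteqP; split => // x [Sx /EA[]]//.
have mF n : measurable (F n) by case: (goodF n).
have Fle n m : (n <= m)%N -> F n `<=` F m.
  move=> /subnK <-; elim: (m - n)%N => // k IH.
  by rewrite addSn /=; apply: subset_trans IH _; left.
pose B := \bigcup_n F n.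
have mB : measurable B by exact: bigcup_measurable.
have BA : B `<=` A by move=> x [n _]; case: (goodF n) => _ + _; exact.
have cvgF : pr (F n) @[n --> \oo] --> pr B.
  apply: fine_cvg; rewrite -/(pr B) -prE//.
  apply: nondecreasing_cvg_mu => //.
  by move=> n m nm; apply/subsetPset/Fle.
have Bt : pr B <= t.
  rewrite -(cvg_lim _ cvgF)//; apply: limr_le; first exact: cvgP cvgF.
  by apply: nearW => n; case: (goodF n).
exists B; split => //; apply/eqP; rewrite eq_le Bt /= leNgt; apply/negP => Blt.
have AB : 0 < pr (A `\` B) by rewrite prDs// subr_gt0 (lt_le_trans Blt).
have [|||E [mE EAB E0 Elt]] := @atomless_small (A `\` B) (t - pr B).
- exact: measurableD.
- exact: AB.
- by rewrite subr_gt0.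
have FB n : F n `<=` B by move=> x Fx; exists n.
have okE n : ok (F n) E.
  split => //.
    by move=> x /EAB[Ax nBx]; split => // /FB.
  rewrite (le_trans (ltW Elt))// lerD2l lerN2.
  exact: le_pr.
have inc n : pr E / 2 <= pr (F n.+1) - pr (F n).
  rewrite FS addrC addKr.
  have [_ /(_ _ (okE n))] := nxtP _ (goodF n).
  lra.
have lin n : n%:R * (pr E / 2) <= pr (F n).
  elim: n => [|n IH]; first by rewrite mul0r pr_ge0.
  rewrite -natr1 mulrDl mul1r; have := inc n; lra.
pose N := Num.bound (2 / pr E).
have : 1 < pr (F N).
  apply: lt_le_trans (lin N).
  rewrite -ltr_pdivrMr ?divr_gt0// mul1r invf_div.
  exact: ltr_bound.
by rewrite ltNge pr_le1.
Qed.
End Sierpinski.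

Section UniformVariable.
Context d (T : measurableType d) (R : realType) (P : probability T R).
Hypothesis hP : atomless P.
Local Notation pr := (pr P).

(** Measurability is asked under the existential quantifier so that choice yields a function [half]
    defined on all sets. *)
Let half_ex (A : set T) : exists B, measurable A ->
  [/\ measurable B, B `<=` A & pr B = pr A / 2].
Proof.
have [mA|] := pselect (measurable A); last by move=> nA; exists set0.
have [|B BP] := atomless_between hP mA (t := pr A / 2); last by exists B.
have := pr_ge0 P A; lra.
Qed.

Let half A := projT1 (cid (half_ex A)).

Let halfP A : measurable A ->
  [/\ measurable (half A), half A `<=` A & pr (half A) = pr A / 2].
Proof. exact: projT2 (cid (half_ex A)). Qed.

(* V n is the integer part of 2 ^ n times the uniform variable. *)
Let V := fix V n : T -> nat := if n is m.+1 then
  fun w => ((V m w).*2 + ~~ `[< half (V m @^-1` [set V m w]) w >])%N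
  else fun=> 0%N.

Let L n j := V n @^-1` [set j].

(** The next binary digit of [w] is 0 exactly on the chosen half of its own level set, so each level
    set of [V n] splits into two level sets of [V n.+1]. *)
Let L_even n j : measurable (L n j) -> L n.+1 j.*2 = half (L n j).
Proof.
move=> mL; have [_ sub _] := halfP mL; apply/seteqP; split => w.
  rewrite /L /=; case: asboolP => h; rewrite ?addn0 ?addn1 => Vj.
    by move: h; rewrite (double_inj Vj).
  by have := congr1 odd Vj; rewrite /= !odd_double.
move=> hw; have Vj : V n w = j by exact: sub hw.
by rewrite /L /= Vj; case: asboolP => [_|/(_ hw)//]; rewrite addn0.
Qed.

Let L_odd n j : measurable (L n j) ->
  L n.+1 j.*2.+1 = L n j `\` half (L n j).
Proof.
move=> mL; have [_ sub _] := halfP mL; apply/seteqP; split => w.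
  rewrite /L /=; case: asboolP => h; rewrite ?addn0 ?addn1 => Vj.
    by have := congr1 odd Vj; rewrite /= !odd_double.
  by case: Vj => /double_inj Vj; split=> //; move: h; rewrite Vj.
move=> [Vj hw]; rewrite /L /= (Vj : V n w = j).
by case: asboolP => [/hw//|_]; rewrite addn1.
Qed.

Let mL n j : measurable (L n j).
Proof.
elim: n j => [|n IH] j.
  have [->|j0] := eqVneq j 0%N.
    by rewrite (_ : L 0 0 = setT)//; apply/seteqP; split.
  rewrite (_ : L 0 j = set0)//; apply/seteqP; split => // w /= jw.
  by rewrite -jw eqxx in j0.
have [mh _ _] := halfP (IH j./2).
rewrite -(odd_double_half j); case: (odd j) => /=.
  by rewrite add1n L_odd//; exact: measurableD.
by rewrite add0n L_even.
Qed.

Let pr_L n j : (j < 2 ^ n)%N -> pr (L n j) = 2^-1 ^+ n.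
Proof.
elim: n j => [|n IH] j.
  rewrite expn0 ltnS leqn0 => /eqP ->; rewrite expr0 -(prT P).
  by congr (pr _); apply/seteqP; split.
move=> jn.
have jn2 : (j./2 < 2 ^ n)%N by rewrite ltn_half_double -mul2n -expnS.
have [mh sh hh] := halfP (mL n j./2).
rewrite -(odd_double_half j); case: (odd j) => /=.
  rewrite add1n L_odd// prDs// hh IH// exprSr; lra.
by rewrite add0n L_even// hh IH// exprSr.
Qed.

Let L_lt n j := [set w | (V n w < j)%N].

Let L_lt0 n : L_lt n 0 = set0.
Proof. by apply/seteqP; split. Qed.

Let L_ltS n j : L_lt n j.+1 = L_lt n j `|` L n j.
Proof.
apply/seteqP; split => w; rewrite /L_lt/L/=.
  by rewrite ltnS leq_eqVlt => /orP[/eqP|]; [right|left].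
by move=> [/ltnW|->].
Qed.

Let mL_lt n j : measurable (L_lt n j).
Proof.
elim: j => [|j IH]; first by rewrite L_lt0.
by rewrite L_ltS; exact: measurableU.
Qed.

Let pr_L_lt n j : (j <= 2 ^ n)%N -> pr (L_lt n j) = j%:R * 2^-1 ^+ n.
Proof.
elim: j => [_|j IH jn].
  by rewrite L_lt0 pr0 mul0r.
rewrite L_ltS prU//.
  by rewrite IH ?pr_L// 1?ltnW// -(natr1 j) mulrDl mul1r.
rewrite disj_set2E; apply/eqP/seteqP; split => // w [].
by rewrite /L_lt/L/= => + Vj; rewrite Vj ltnn.
Qed.

Let u n w : R := (V n w)%:R * 2^-1 ^+ n.

(** Digit [m] adds at most [2^-1 ^+ m]; keeping the geometric remainder [- 2^-1 ^+ (n + k)] lets the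
    induction close. *)
Let u_incr n k w : u n w <= u (n + k) w <= u n w + 2^-1 ^+ n - 2^-1 ^+ (n + k).
Proof.
elim: k => [|k /andP[IH1 IH2]].
  by rewrite addn0 lexx /=; lra.
have : u (n + k) w <= u (n + k.+1) w <= u (n + k) w + 2^-1 ^+ (n + k).+1.
  rewrite addnS /u /=; set b := ~~ _.
  have -> : (V (n + k) w)%:R * 2^-1 ^+ (n + k) =
     ((V (n + k) w).*2)%:R * 2^-1 ^+ (n + k).+1 :> R.
    rewrite -mul2n natrM exprS; lra.
  rewrite natrD mulrDl lerDl mulr_ge0//= lerD2l.
  by case: b; rewrite ?mul1r// mul0r exprn_ge0.
move=> /andP[h1 h2]; rewrite (le_trans IH1)//= (le_trans h2)//.
by move: IH2; rewrite addnS exprS; lra.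
Qed.

Let U w := sup (range (u ^~ w)).

Let U_bounds n w : u n w <= U w <= u n w + 2^-1 ^+ n.
Proof.
have ub k : u k w <= u n w + 2^-1 ^+ n.
  have e0 m : 0 <= 2^-1 ^+ m :> R by rewrite exprn_ge0.
  case/orP: (leq_total n k) => /subnKC <-.
    have /andP[_ /le_trans] := u_incr n (k - n) w; apply.
    by rewrite gerBl.
  have /andP[/le_trans + _] := u_incr k (n - k) w; apply.
  by rewrite lerDl.
apply/andP; split.
  apply: ub_le_sup; last by exists n.
  by exists (u n w + 2^-1 ^+ n) => _ [k _ <-].
by apply: ge_sup => [|_ [k _ <-]//]; exists (u 0 w), 0%N.
Qed.

Let small (x : R) : (forall n, x <= 2^-1 ^+ n) -> x <= 0.
Proof.
move=> h; rewrite leNgt; apply/negP => x0.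
have := h (Num.bound x^-1); rewrite leNgt => /negP; apply.
rewrite exprVn -ltf_pV2 ?posrE ?invr_gt0 ?exprn_gt0// invrK.
by rewrite upper_nthrootP.
Qed.

Let mu_ n : measurable_fun setT (u n).
Proof.
apply: measurable_funM => //; move=> _ A mA; rewrite setTI.
rewrite (_ : _ @^-1` _ =
   \bigcup_(j in [set j | A j%:R]) L n j); first exact: bigcup_measurable.
apply/seteqP; split => [w /= Aw|w [j /= Aj Vj]].
  by exists (V n w).
by move: Aj; rewrite -Vj.
Qed.

Let U_le x : [set w | U w <= x] = \bigcap_n [set w | u n w <= x].
Proof.
apply/seteqP; split => [w Ux n _ /=|w ux /=].
  by have /andP[/le_trans ->] := U_bounds n w.
by apply: ge_sup => [|_ [k _ <-]]; [exists (u 0 w), 0%N|exact: (ux k I)].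
Qed.

Let measurable_U : measurable_fun setT U.
Proof.
apply: (@measurability _ _ _ _ _ _ (@RGenOInfty.G R)).
  exact: RGenOInfty.measurableE.
move=> _ [_ [x ->]] <-; rewrite setTI.
rewrite (_ : U @^-1` _ = ~` [set w | U w <= x]).
  rewrite U_le; apply/measurableC/bigcapT_measurable => n.
  exact: measurable_set_le.
by apply/seteqP; split => w /=; rewrite in_itv/= andbT ltNge => /negP.
Qed.

(** With [j] the integer part of [x * 2 ^+ n], the event [U w <= x] lies between [V n w < j] and
    [V n w < j.+1], whose masses differ by [2^-1 ^+ n]. *)
Let pr_U x : 0 <= x < 1 -> pr [set w | U w <= x] = x.
Proof.
move=> /andP[x0 x1]; set y := pr _.
have h n : x - y <= 2^-1 ^+ n /\ y - x <= 2^-1 ^+ n.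
  have e0 : 0 < 2^-1 ^+ n :> R by rewrite exprn_gt0.
  have ee : 2 ^+ n * 2^-1 ^+ n = 1 :> R by rewrite -exprMn divff// expr1n.
  have xE : x = x * 2 ^+ n * 2^-1 ^+ n by rewrite -mulrA ee mulr1.
  pose j := Num.truncn (x * 2 ^+ n).
  have /andP[j1 j2] : j%:R <= x * 2 ^+ n < j.+1%:R.
    by apply: truncn_itv; rewrite mulr_ge0// exprn_ge0.
  have jn : (j < 2 ^ n)%N.
    rewrite -(ltr_nat R) natrX (le_lt_trans j1)//.
    by rewrite gtr_pMl// exprn_gt0.
  have {}j1 : j%:R * 2^-1 ^+ n <= x.
    by rewrite [leRHS]xE ler_pM2r.
  have {}j2 : x < j%:R * 2^-1 ^+ n + 2^-1 ^+ n.
    by rewrite [ltLHS]xE -[X in _ + X]mul1r -mulrDl natr1 ltr_pM2r.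
  have l1 : j%:R * 2^-1 ^+ n <= y.
    rewrite -pr_L_lt 1?ltnW//; apply: le_pr => //;
      first exact: measurable_set_le.
    move=> w; rewrite /L_lt /= => Vj.
    have /andP[_ /le_trans->//] := U_bounds n w.
    apply: le_trans j1; rewrite /u -[X in _ + X]mul1r -mulrDl natr1.
    by rewrite ler_pM2r// ler_nat.
  have l2 : y <= j%:R * 2^-1 ^+ n + 2^-1 ^+ n.
    rewrite -[X in _ + X]mul1r -mulrDl natr1 -pr_L_lt//.
    apply: le_pr => //; first exact: measurable_set_le.
    move=> w /= Uw; rewrite /L_lt/= ltnS -ltnS.
    have : u n w < j.+1%:R * 2^-1 ^+ n.
      rewrite -(natr1 j) mulrDl mul1r; apply: le_lt_trans j2.
      by have /andP[/le_trans ->] := U_bounds n w.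
    by rewrite /u ltr_pM2r// ltr_nat.
  split; lra.
apply/eqP; rewrite eq_le -[y <= x]subr_le0 -[x <= y]subr_le0.
by rewrite !small// => n; case: (h n).
Qed.

Lemma atomless_uniform : exists U : T -> R, [/\ measurable_fun setT U,
  forall w, 0 < U w < 1 &
  forall x, 0 <= x <= 1 -> pr [set w | U w <= x] = x].
Proof.
(* [U] may reach 0 or 1 on this null set; overwriting it there by [2^-1] makes the strict bounds
   hold at every point. *)
pose N := [set w | U w <= 0] `|` ~` [set w | U w < 1].
have m1 : measurable [set w | U w < 1] by exact: measurable_set_lt.
have m0 : measurable [set w | U w <= 0] by exact: measurable_set_le.
have pr1 : pr [set w | U w < 1] = 1.
  apply/eqP; rewrite eq_le pr_le1//= leNgt; apply/negP.
  set y := pr _ => y1.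
  have y0 : 0 <= y by exact: pr_ge0.
  suff : (y + 1) / 2 <= y by lra.
  rewrite -[leLHS]pr_U; last by lra.
  apply: le_pr => //; first exact: measurable_set_le.
  by move=> w /= /le_lt_trans; apply; lra.
have mN : measurable N by apply: measurableU => //; exact: measurableC.
have N0 : pr N = 0.
  apply/eqP; rewrite eq_le pr_ge0 andbT /N.
  have := @prDI _ _ _ P N [set w | U w <= 0] mN m0.
  rewrite (_ : N `&` _ = [set w | U w <= 0]); last first.
    by rewrite setIC; apply/setIidPl; left.
  rewrite pr_U ?lexx ?ltr01// addr0 -/N => ->.
  rewrite -[leRHS](_ : pr (~` [set w | U w < 1]) = 0).
    apply: le_pr; [exact: measurableD|exact: measurableC|].
    by move=> w [[//|]].
  by rewrite -setTD prDs// prT pr1 subrr.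
pose U' w := if (0 < U w) && (U w < 1) then U w else 2^-1.
exists U'; split.
- apply: measurable_fun_if => //.
  + apply: measurable_and; first exact: measurable_fun_ltr.
    exact: measurable_fun_ltr.
  + exact: measurable_funS measurable_U.
- by move=> w; rewrite /U'; case: ifPn => //; lra.
- move=> x /andP[x0 x1].
  have mU' : measurable_fun setT U'.
    apply: measurable_fun_if => //.
      apply: measurable_and; first exact: measurable_fun_ltr.
      exact: measurable_fun_ltr.
    exact: measurable_funS measurable_U.
  have U'E w : (~` N) w -> U' w = U w.
    move=> Nw; rewrite /U' ifT//; apply/andP; split.
      by rewrite ltNge; apply/negP => U0; apply: Nw; left.
    by apply: contrapT => U1; apply: Nw; right.
  have mx : measurable [set w | U' w <= x] by exact: measurable_set_le.
  have mx' : measurable [set w | U w <= x] by exact: measurable_set_le.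
  have cN0 : pr (~` ~` N) = 0 by rewrite setCK.
  have -> : pr [set w | U' w <= x] = pr [set w | U w <= x].
    rewrite -(pr_setI_full mx _ cN0); last exact: measurableC.
    rewrite -(pr_setI_full mx' _ cN0); last exact: measurableC.
    congr (pr _); apply/seteqP.
    by split => w [/= + Nw]; rewrite (U'E _ Nw).
  have [xl|] := ltP x 1; first by rewrite pr_U// x0.
  move=> xg; have {xg x1} -> : x = 1 by apply/eqP; rewrite eq_le x1.
  apply/eqP; rewrite eq_le pr_le1//=; last exact: measurable_set_le.
  rewrite -[X in X <= _]pr1.
  by apply: le_pr => //; [exact: measurable_set_le|move=> w /=; exact: ltW].
Qed.
End UniformVariable.

(** * Copulas *)

Section UniformCdf.
Variable R : realType.

Lemma uniform_prob_ray (u : R) : 0 <= u <= 1 ->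
  uniform_prob (@ltr01 R) `]-oo, u]%classic = u%:E.
Proof.
move=> /andP[u0 u1]; rewrite /uniform_prob integral_uniform_pdf.
rewrite (_ : _ `&` _ = `[0, u]%classic); last first.
  apply/seteqP; split => x /=; rewrite !in_itv/=.
    by move=> [xu /andP[-> _]].
  by move=> /andP[x0 xu]; rewrite x0 xu (le_trans xu u1).
rewrite (eq_integral (fun=> 1%:E)); last first.
  move=> x; rewrite inE/= in_itv/= => /andP[x0 xu].
  by rewrite /uniform_pdf x0 (le_trans xu u1) subr0 invr1.
rewrite integral_cst//= mul1e lebesgue_measure_itv/= lte_fin sube0.
by case: ltgtP u0 => // <-.
Qed.

End UniformCdf.

Section CopulaFacts.
Variables (R : realType) (C : R -> R -> R).
Hypothesis hC : copula C.

Lemma copula_prob : exists (mu : probability (R * R)%type R),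
  (forall u v, C u v = pr mu ([set z | z.1 <= u] `&` [set z | z.2 <= v])) /\
  (forall u, 0 <= u <= 1 ->
     pr mu [set z | z.1 <= u] = u /\ pr mu [set z | z.2 <= u] = u).
Proof.
have [mu [h1 h2 h3]] := hC; exists mu; split => [u v|u u01].
  apply: EFin_inj; rewrite -h3 -prE.
    by congr (mu _).
  by apply: measurableI; exact: measurable_set_le.
split; apply: EFin_inj; rewrite -prE; try exact: measurable_set_le.
  by rewrite -uniform_prob_ray// -h1//; congr (mu _).
by rewrite -uniform_prob_ray// -h2//; congr (mu _).
Qed.

Let mle1 (u : R) : measurable [set z : R * R | z.1 <= u].
Proof. exact: measurable_set_le. Qed.

Let mle2 (u : R) : measurable [set z : R * R | z.2 <= u].
Proof. exact: measurable_set_le. Qed.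

Lemma copula_le1 u v : 0 <= u <= 1 -> C u v <= u.
Proof.
have [mu [CE muE]] := copula_prob; move=> u01.
rewrite CE -[leRHS](muE u u01).1; apply: le_pr => //; exact: measurableI.
Qed.

Lemma copula_le2 u v : 0 <= v <= 1 -> C u v <= v.
Proof.
have [mu [CE muE]] := copula_prob; move=> v01.
rewrite CE -[leRHS](muE v v01).2; apply: le_pr => //; exact: measurableI.
Qed.

Lemma copula_mono u u' v v' : u <= u' -> v <= v' -> C u v <= C u' v'.
Proof.
have [mu [CE _]] := copula_prob; move=> uu vv.
rewrite !CE; apply: le_pr; try exact: measurableI.
by move=> z [/= z1 z2]; split => /=; [exact: le_trans uu|exact: le_trans vv].
Qed.

Lemma copula_nonpos u v : (u <= 0) || (v <= 0) -> C u v = 0.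
Proof.
have [mu [CE muE]] := copula_prob => uv.
apply/eqP; rewrite eq_le; apply/andP; split; last by rewrite CE pr_ge0.
have h0 : 0 <= (0 : R) <= 1 by rewrite lexx ler01.
case/orP: uv => uv.
  by rewrite (le_trans (copula_mono uv (lexx v)))// copula_le1.
by rewrite (le_trans (copula_mono (lexx u) uv))// copula_le2.
Qed.

(** The two squares differ by an L-shaped region, covered by two strips of mass [q - p] each since
    the marginals are uniform. *)
Lemma copula_diag_lip p q : 0 <= p -> p <= q -> q <= 1 ->
  C q q <= C p p + 2 * (q - p).
Proof.
move=> p0 pq q1; have [mu [CE muE]] := copula_prob.
have [p01 q01] : 0 <= p <= 1 /\ 0 <= q <= 1 by lra.
have [mp1 mp2] := muE p p01; have [mq1 mq2] := muE q q01.
set A := fun u => [set z : R * R | z.1 <= u] in mp1 mq1 *.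
set B := fun u => [set z : R * R | z.2 <= u] in mp2 mq2 *.
have mA u : measurable (A u) by exact: mle1.
have mB u : measurable (B u) by exact: mle2.
have sA : pr mu (A q `\` A p) = q - p.
  rewrite prDs// ?mq1 ?mp1// => z /=; rewrite /A /= => zp; exact: le_trans pq.
have sB : pr mu (B q `\` B p) = q - p.
  rewrite prDs// ?mq2 ?mp2// => z /=; rewrite /B /= => zp; exact: le_trans pq.
have mAB u : measurable (A u `&` B u) by exact: measurableI.
pose S := (A q `&` B q) `\` (A p `&` B p).
have mS : measurable S by exact: measurableD.
have e1 : pr mu (A q `&` B q) = pr mu S + pr mu (A p `&` B p).
  rewrite (prDI mu (mAB q) (mAB p)) -/S; congr (_ + pr mu _).
  rewrite setIC; apply/setIidPl => z [/= z1 z2].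
  by split => /=; [exact: le_trans pq|exact: le_trans pq].
have e2 := prDI mu mS (mA p).
have e3 : pr mu (S `\` A p) <= q - p.
  rewrite -sA; apply: le_pr; [exact: measurableD|exact: measurableD|].
  by move=> z [[[? ?] _] ?]; split.
have e4 : pr mu (S `&` A p) <= q - p.
  rewrite -sB; apply: le_pr; [exact: measurableI|exact: measurableD|].
  by move=> z [[[? ?] h] ?]; split => // ?; apply: h.
rewrite (CE q) (CE p) -/(A q) -/(A p) -/(B q) -/(B p) e1 e2; lra.
Qed.

End CopulaFacts.

(** * Countable mixtures of copulas *)

Section Mixture.
Variables (R : realType) (m : nat -> probability (R * R)%type R).
Variables (lambda : nat -> R) (lambda0 : forall n, 0 <= lambda n).
Hypothesis lambda1 : series lambda @ \oo --> (1 : R).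

Definition mixture : set (R * R) -> \bar R :=
  mseries (fun n => mscale (NngNum (lambda0 n)) (m n)) 0.

HB.instance Definition _ := Measure.on mixture.

Lemma mixtureE A : mixture A = (\sum_(0 <= n <oo) (lambda n)%:E * m n A)%E.
Proof. by []. Qed.

(** Bridge to [copula_series], which is a limit of reals: comparison with [lambda] makes the real
    series converge, so its limit is the extended sum. *)
Lemma mixture_real A (f : nat -> R) : (forall n, m n A = (f n)%:E) ->
  (forall n, f n <= 1) ->
  mixture A = (limn (series (fun n => lambda n * f n)))%:E.
Proof.
move=> mf f1; rewrite mixtureE -EFin_lim.
  congr (limn _); apply/funext => n /=; rewrite /series/= -sumEFin.
  by apply: eq_bigr => i _; rewrite mf.
apply: (@series_le_cvg _ _ lambda).
- move=> n; rewrite mulr_ge0// -lee_fin -mf; exact: measure_ge0.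
- by [].
- by move=> n; rewrite ler_piMr.
- by apply/cvg_ex; exists 1.
Qed.

Lemma mixture_cst A (r : R) : r <= 1 -> (forall n, m n A = r%:E) ->
  mixture A = r%:E.
Proof.
move=> r1 mr; rewrite (@mixture_real _ (fun=> r))//; congr EFin.
apply/cvg_lim => //.
rewrite (_ : series _ = (fun n => series lambda n * r)); last first.
  by apply/funext => n; rewrite /series/= mulr_suml.
by rewrite -[X in _ --> X]mul1r; apply: cvgMr_tmp.
Qed.

Lemma mixture_setT : mixture setT = 1%E.
Proof. by rewrite (@mixture_cst _ 1)// => n; rewrite probability_setT. Qed.

HB.instance Definition _ := Measure_isProbability.Build _ _ _ mixture
  mixture_setT.

Definition mixture_prob : probability (R * R)%type R := mixture.

End Mixture.

Section MixtureCopula.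
Variables (R : realType) (C : nat -> R -> R -> R) (lambda : nat -> R).
Hypotheses (hC : forall n, copula (C n)) (lambda0 : forall n, 0 <= lambda n).
Hypothesis lambda1 : series lambda @ \oo --> (1 : R).

(** The mixture of the underlying measures has this distribution function, and uniform marginals
    because the weights sum to 1. *)
Lemma copula_copula_series : copula (copula_series lambda C).
Proof.
pose m n := projT1 (cid (hC n)).
have mP n := projT2 (cid (hC n)).
exists (mixture_prob m lambda0 lambda1); split.
- move=> A mA; rewrite /pushforward/=.
  have e n : m n (fst @^-1` A) = (fine (uniform_prob (@ltr01 R) A))%:E.
    have [h _ _] := mP n; rewrite fineK ?fin_num_measure//; exact: h.
  rewrite (mixture_cst lambda0 lambda1 _ e) ?fineK ?fin_num_measure//.
  by rewrite -lee_fin fineK ?fin_num_measure// probability_le1.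
- move=> A mA; rewrite /pushforward/=.
  have e n : m n (snd @^-1` A) = (fine (uniform_prob (@ltr01 R) A))%:E.
    have [_ h _] := mP n; rewrite fineK ?fin_num_measure//; exact: h.
  rewrite (mixture_cst lambda0 lambda1 _ e) ?fineK ?fin_num_measure//.
  by rewrite -lee_fin fineK ?fin_num_measure// probability_le1.
- move=> u v; rewrite /= (@mixture_real _ _ _ _ _ _ (fun n => C n u v))//.
    by move=> n; have [_ _ ->] := mP n.
  move=> n; have [_ _ h] := mP n.
  by rewrite -lee_fin -h probability_le1//; apply: measurableX.
Qed.

End MixtureCopula.

(** * Diagonal classes are concentration classes *)

Section CdfFacts.
Context d (T : measurableType d) (R : realType) (P : probability T R).
Implicit Types X Y : {RV P >-> R}.

Lemma measurable_RV_le X x : measurable [set w | X w <= x].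
Proof. exact: measurable_set_le. Qed.

Lemma cdfE X x : fine (cdf X x) = pr P [set w | X w <= x].
Proof.
by rewrite /cdf/distribution/pushforward/=; congr (fine (P _)).
Qed.

Lemma eq_in_law_pr X Y x : eq_in_law X Y ->
  pr P [set w | X w <= x] = pr P [set w | Y w <= x].
Proof.
move=> XY; rewrite -!cdfE /cdf XY//.
Qed.

Lemma continuous_fine_cdf X : continuous (cdf X) ->
  continuous (fun x => fine (cdf X x)).
Proof.
move=> cX x; apply: fine_cvg; rewrite fineK; first exact: cX.
by rewrite fin_num_measure.
Qed.

Lemma cdf_surj X p : continuous (cdf X) -> 0 < p < 1 ->
  exists q, fine (cdf X q) = p.
Proof.
move=> cX /andP[p0 p1].
have cF := continuous_fine_cdf cX.
have [a aP] : exists a, fine (cdf X a) < p.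
  have /fine_cvg h := @cvg_cdfNy0 _ _ _ _ X.
  have : \forall a \near -oo, fine (cdf X a) < p by apply: (cvgr_lt _ h).
  by move=> /filter_ex.
have [b bP] : exists b, p < fine (cdf X b).
  have /fine_cvg h := @cvg_cdfy1 _ _ _ _ X.
  have : \forall b \near +oo, p < fine (cdf X b) by apply: (cvgr_gt _ h).
  by move=> /filter_ex.
have ab : a <= b.
  rewrite leNgt; apply/negP => ba.
  have := cdf_nondecreasing X (ltW ba); rewrite leNgt => /negP; apply.
  rewrite -[cdf X a]fineK ?fin_num_measure//.
  rewrite -[cdf X b]fineK ?fin_num_measure// lte_fin; exact: lt_trans aP bP.
have [||q _ <-] := @IVT R (fun x => fine (cdf X x)) a b p ab.
- by apply: continuous_subspaceT => x; exact: cF.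
- rewrite minElt maxElt (lt_trans aP bP).
  by rewrite (ltW aP) (ltW bP).
by exists q.
Qed.

End CdfFacts.

Section DiagonalClass.
Context d (T : measurableType d) (R : realType) (P : probability T R).
Local Notation pr := (pr P).

(** The average of the indicators has expectation [r]; it is at most [a] off [G] and at most 1 on
    [G]. *)
Lemma average_indic_le (B : nat -> set T) (G : set T) (n : nat) (a r : R) :
  (forall i, measurable (B i)) -> (forall i, pr (B i) = r) ->
  measurable G -> 0 <= a ->
  (forall w, ~ G w -> n.+1%:R^-1 * (\sum_(i < n.+1) \1_(B i) w) <= a) ->
  r <= a + pr G.
Proof.
move=> mB prB mG a0 BG.
have n0 : 0 < n.+1%:R :> R by [].
have B1 i w : 0 <= (\1_(B i) w : R) <= 1.
  by rewrite indicE; case: (w \in B i); rewrite /= ?lexx ler01.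
have ptw w : \sum_(i < n.+1) (\1_(B i) w : R) <= n.+1%:R * a + n.+1%:R * \1_G w.
  have [Gw|nGw] := pselect (G w).
    rewrite (@le_trans _ _ (n.+1%:R))//.
      apply: (@le_trans _ _ (\sum_(i < n.+1) 1));
        last by rewrite sumr_const card_ord.
      by apply: ler_sum => i _; have /andP[] := B1 i w.
    by rewrite indicE mem_set// mulr1 lerDr mulr_ge0.
  by rewrite indicE memNset// mulr0 addr0 mulrC -ler_pdivrMr// mulrC BG.
have intI (A : set T) : measurable A ->
    (\int[P]_w (\1_A w)%:E = (pr A)%:E)%E.
  by move=> mA; rewrite integral_indic// setIT; exact: prE.
have intB i : (\int[P]_w (\1_(B i) w)%:E = r%:E)%E by rewrite intI// prB.
have mr : measurable_fun setT (fun w => n.+1%:R * (\1_G w : R)).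
  by apply: measurable_funM => //; exact: measurable_indic.
have mr' : measurable_fun setT (fun w => n.+1%:R * a + n.+1%:R * \1_G w).
  exact: measurable_funD.
have : (\int[P]_w (\sum_(i < n.+1) (\1_(B i) w : R))%:E <=
        \int[P]_w (n.+1%:R * a + n.+1%:R * \1_G w)%:E)%E.
  apply: ge0_le_integral => //.
  - by move=> w _; rewrite lee_fin sumr_ge0// => i _; have /andP[] := B1 i w.
  - apply/measurable_EFinP; apply: measurable_sum => i.
    exact: measurable_indic.
  - by apply: measurableT_comp.
  - by move=> w _; rewrite lee_fin.
under eq_integral do rewrite -sumEFin.
rewrite ge0_integral_sum//; last first.
  by move=> i; apply/measurable_EFinP; exact: measurable_indic.
under eq_bigr do rewrite intB.
under eq_integral do rewrite EFinD.
rewrite ge0_integralD//; last 2 first.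
- by move=> w _; rewrite lee_fin mulr_ge0.
- by apply: measurableT_comp.
under [X in (_ + X)%E]eq_integral do rewrite EFinM.
rewrite ge0_integralZl//; last first.
  by apply/measurable_EFinP; exact: measurable_indic.
rewrite intI// integral_cst//= probability_setT mule1.
rewrite sumEFin -!EFinM -EFinD lee_fin sumr_const card_ord -[r *+ _]mulr_natl.
by rewrite -mulrDr ler_pM2l.
Qed.

(* The events [X n <= q], with [q] a [p]-quantile, are almost surely equal for
   all [n], so on each side of [q] the averages stay on that side; the averages
   could only tend to [q] itself, which the bounded variables
   [(q - q') * \1_(X n <= q')] with [q' < q] rule out in expectation. *)
Lemma diagonal_class_ND (C : R -> R -> R) (p : R) : 0 < p < 1 ->
  diagonal_class p C -> non_diversifiable P C.
Proof.
move=> /andP[p0 p1] [hC Cpp] X [XL XC] cvgX.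
have cX n : continuous (cdf (X n)) by case: (XL n).
have [q Fq] : exists q, fine (cdf (X 0) q) = p by apply: cdf_surj => //; lra.
(* A strictly lower quantile, of mass [p / 2], for the case where the mean equals [q]. *)
have [q' Fq'] : exists q', fine (cdf (X 0) q') = p / 2.
  by apply: cdf_surj => //; lra.
have qq : q' < q.
  rewrite ltNge; apply/negP => qq'; have := cdf_nondecreasing (X 0) qq'.
  rewrite -[cdf _ q]fineK ?fin_num_measure//.
  rewrite -[cdf _ q']fineK ?fin_num_measure// lee_fin Fq Fq'; lra.
have law n x : pr [set w | X n w <= x] = fine (cdf (X 0) x).
  elim: n => [|n <-]; first by rewrite cdfE.
  by rewrite (eq_in_law_pr _ (XC n).1).
pose A n := [set w | X n w <= q].
have mA n : measurable (A n) by exact: measurable_RV_le.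
have prA n : pr (A n) = p by rewrite law.
have prAA n : pr (A n `&` A n.+1) = p.
  have [_ [_ /(_ q q)]] := XC n.
  rewrite !cdfE !law !Fq Cpp => e; apply: EFin_inj; rewrite -e -prE.
    by congr (P _).
  exact: measurableI.
have D1 n : pr (A n `\` A n.+1) = 0.
  by apply/eqP; rewrite -(inj_eq (addIr p)) add0r -[X in _ +
    X](prAA n) -prDI ?prA.
have D2 n : pr (A n.+1 `\` A n) = 0.
  apply/eqP; rewrite -(inj_eq (addIr p)) add0r -[X in _ + X](prAA n) setIC.
  by rewrite -prDI ?prA.
pose N := \bigcup_n ((A n `\` A n.+1) `|` (A n.+1 `\` A n)).
have mN : measurable N.
  by apply: bigcup_measurable => n _; apply: measurableU; exact: measurableD.
have N0 : pr (~` ~` N) = 0.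
  rewrite setCK /pr.
  suff /negligibleP -> : P.-negligible N by [].
  apply: negligible_bigcup => n; apply: negligibleU.
    by apply/negligibleP; [exact: measurableD|apply: pr_null => //;
      exact: measurableD].
  by apply/negligibleP; [exact: measurableD|apply: pr_null => //;
    exact: measurableD].
have AN w n : ~ N w -> (A n w <-> A 0 w).
  move=> Nw; elim: n => // n IH; rewrite -IH; split => h; apply: contrapT => h'.
    by apply: Nw; exists n => //; right.
  by apply: Nw; exists n => //; left.
pose m := fine 'E_P[X 0].
pose avg n w := n.+1%:R^-1 * (\sum_(i < n.+1) X i w).
pose bad e n := [set w | e < `|avg n w - m|].
have mavg n : measurable_fun setT (avg n).
  by apply: measurable_funM => //; apply: measurable_sum => i.
have mbad e n : measurable (bad e n).
  rewrite (_ : bad e n = ~` [set w | `|avg n w - m| <= e]).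
    apply: measurableC; apply: measurable_set_le.
    by apply: measurableT_comp => //; apply: measurable_funB.
  by apply/seteqP; split => w /=; rewrite /bad/= ltNge => /negP.
have small e eta : 0 < e -> 0 < eta -> exists n, pr (bad e n) < eta.
  move=> e0 eta0.
  have h := cvgX e e0.
  have /fine_cvg : (pr (bad e n))%:E @[n --> \oo] --> (0 : R)%:E.
    apply: cvg_trans h; apply: near_eq_cvg; apply: nearW => n.
    rewrite -prE//; congr (P _); apply/seteqP.
    by split => w; rewrite /bad/= /centered_average subr0.
  move=> /(cvgr_lt _)/(_ _ eta0) [n _ /(_ n (leqnn n))].
  by exists n.
have avg_le n w : ~ N w -> A 0%N w -> avg n w <= q.
  move=> Nw Aw; rewrite /avg mulrC ler_pdivrMr//.
  apply: (@le_trans _ _ (\sum_(i < n.+1) q)).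
    by apply: ler_sum => i _; exact: (AN w i Nw).2.
  by rewrite sumr_const card_ord mulr_natr.
have avg_ge n w : ~ N w -> ~ A 0%N w -> q <= avg n w.
  move=> Nw Aw; rewrite /avg mulrC ler_pdivlMr//.
  apply: (@le_trans _ _ (\sum_(i < n.+1) q)).
    by rewrite sumr_const card_ord mulr_natr.
  by apply: ler_sum => i _; rewrite ltW// ltNge; apply/negP => /(AN w i Nw).1.
have mNc : measurable (~` N) by exact: measurableC.
(* If [m] is not [q], the averages stay beyond [q], seen from [m], on an event of fixed positive
   mass: the complement of [A 0] if [m < q], [A 0] if [q < m]. *)
have [mq|qm|mq] := ltgtP m q.
- have [||n] := small ((q - m) / 2) (1 - p); [lra|lra|].
  rewrite ltNge => /negP; apply.
  have -> : 1 - p = pr (~` A 0%N `&` ~` N).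
    rewrite pr_setI_full//; last exact: measurableC.
    by rewrite -setTD prDs// prT prA.
  apply: le_pr => //.
    by apply: measurableI => //; exact: measurableC.
  move=> w [Aw Nw]; have := avg_ge n w Nw Aw; rewrite /bad/= => h.
  by rewrite gtr0_norm; lra.
- have [||n] := small ((m - q) / 2) p; [lra|lra|].
  rewrite ltNge => /negP; apply.
  rewrite -[leLHS](prA 0%N) -(pr_setI_full _ mNc)//.
  apply: le_pr => //; first exact: measurableI.
  move=> w [Aw Nw]; have := avg_le n w Nw Aw; rewrite /bad/= => h.
  by rewrite ltr0_norm; lra.
- have c0 : 0 < q - q' by rewrite subr_gt0.
  (* Off the bad event and [N] the indicators of the [B i] average to at most [p / 8]; in
     expectation [p / 2] would be less than [p / 8 + p / 8]. *)
  have [||n badn] := small (p / 8 * (q - q')) (p / 8).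
  + by rewrite mulr_gt0//; lra.
  + by lra.
  pose B i := [set w | X i w <= q'].
  have mG : measurable (bad (p / 8 * (q - q')) n `|` N) by exact: measurableU.
  have : p / 2 <= p / 8 + pr (bad (p / 8 * (q - q')) n `|` N).
    apply: (@average_indic_le B _ n) => //.
    + by move=> i; exact: measurable_RV_le.
    + by move=> i; rewrite law.
    + lra.
    + move=> w /not_orP[/negP]; rewrite -leNgt mq => badw Nw.
      rewrite -(ler_pM2r c0) (le_trans _ badw)// -mulrA mulr_suml.
      (* On [A 0] each [q - X i w] is nonnegative, and at least [q - q'] if [B i] occurs; off [A 0]
         no [B i] occurs. *)
      have [Aw|nAw] := pselect (A 0%N w).
        rewrite -normrN opprB (le_trans _ (ler_norm _))//.
        have -> : q - avg n w = n.+1%:R^-1 * \sum_(i < n.+1) (q - X i w).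
          rewrite sumrB sumr_const card_ord mulrBr; congr (_ - _).
          by rewrite -[q *+ _]mulr_natl mulrA mulVf ?mul1r.
        rewrite ler_pM2l ?invr_gt0//; apply: ler_sum => i _.
        rewrite indicE; have [Bw|nBw] := pselect (B i w).
          by rewrite mem_set// mul1r lerD2l lerN2.
        by rewrite memNset// mul0r subr_ge0; exact: (AN w i Nw).2.
      rewrite big1 ?mulr0// => i _; rewrite indicE memNset ?mul0r//.
      move=> Bw; apply: nAw; apply: (AN w i Nw).1.
      by rewrite /A/= (le_trans Bw)// ltW.
  have : pr (bad (p / 8 * (q - q')) n `|` N) <= pr (bad (p / 8 * (q - q')) n).
    rewrite -(pr_setI_full _ mNc N0)//; apply: le_pr => //.
      exact: measurableI.
    by move=> w [[]].
  lra.
Qed.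

(** As [p] is the largest value a copula can take at [(p, p)], a larger copula takes it too; a
    mixture takes it because the weights sum to 1. *)
Lemma diagonal_class_concentration (p : R) : 0 < p < 1 ->
  concentration_class P (diagonal_class p).
Proof.
move=> /andP[p0 p1].
have p01 : 0 <= p <= 1 by lra.
split.
- by move=> C [].
- by move=> C; apply: diagonal_class_ND; rewrite p0.
- move=> C C' [hC Cp] hC' CC'; split => //; apply/eqP; rewrite eq_le.
  by rewrite copula_le1//= -{1}Cp CC'.
- move=> C lambda DC l0 l1; split.
    by apply: copula_copula_series => // n; case: (DC n).
  rewrite /copula_series.
  rewrite (_ : (fun n => lambda n * C n p p) = (fun n => lambda n * p)).
    apply/cvg_lim => //.
    rewrite (_ : series _ = (fun n => series lambda n * p)); last first.
      by apply/funext => n; rewrite /series/= mulr_suml.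
    by rewrite -[X in _ --> X]mul1r; apply: cvgMr_tmp.
  by apply/funext => n; case: (DC n) => _ ->.
Qed.

End DiagonalClass.

(** * The copula of a pair with continuous law *)

Section CopulaInterior.
Variable R : realType.
Implicit Types C : R -> R -> R.

Lemma copula_ge1l C u v : copula C -> 1 <= u -> 0 <= v <= 1 -> C u v = v.
Proof.
move=> hC u1 v01; apply/eqP; rewrite eq_le copula_le2//=.
apply: le_trans (copula_mono hC u1 (lexx v)).
have [mu [CE muE]] := copula_prob hC; rewrite CE setIC pr_setI_full//.
- by rewrite (muE v v01).2.
- exact: measurable_set_le.
- exact: measurable_set_le.
have m1 : measurable [set z : R * R | z.1 <= 1] by exact: measurable_set_le.
by rewrite -setTD prDs// prT (muE 1 _).1 ?subrr// ler01 lexx.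
Qed.

Lemma copula_ge1r C u v : copula C -> 1 <= v -> 0 <= u <= 1 -> C u v = u.
Proof.
move=> hC v1 u01; apply/eqP; rewrite eq_le copula_le1//=.
apply: le_trans (copula_mono hC (lexx u) v1).
have [mu [CE muE]] := copula_prob hC; rewrite CE pr_setI_full//.
- by rewrite (muE u u01).1.
- exact: measurable_set_le.
- exact: measurable_set_le.
have m1 : measurable [set z : R * R | z.2 <= 1] by exact: measurable_set_le.
by rewrite -setTD prDs// prT (muE 1 _).2 ?subrr// ler01 lexx.
Qed.

Lemma copula_ge1 C u v : copula C -> 1 <= u -> 1 <= v -> C u v = 1.
Proof.
move=> hC u1 v1; apply/eqP; rewrite eq_le; apply/andP; split.
  have [mu [CE muE]] := copula_prob hC; rewrite CE pr_le1//.
  by apply: measurableI; exact: measurable_set_le.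
rewrite -[leLHS](@copula_ge1l C 1 1) ?lexx ?ler01//; exact: copula_mono.
Qed.

(** All copulas agree outside the open unit square. Inside it every level is a value of a continuous
    cdf, so domination can be tested on events. *)
Lemma copula_le_interior C C' : copula C -> copula C' ->
  (forall u v, 0 < u < 1 -> 0 < v < 1 -> C u v <= C' u v) -> copula_le C C'.
Proof.
move=> hC hC' CC' u v.
have [u0|u0] := leP u 0; first by rewrite !copula_nonpos ?u0.
have [v0|v0] := leP v 0; first by rewrite !copula_nonpos ?v0 ?orbT.
have [u1|u1] := leP 1 u; have [v1|v1] := leP 1 v.
- by rewrite !copula_ge1.
- by rewrite !copula_ge1l// !ltW.
- by rewrite !copula_ge1r// !ltW.
- by apply: CC'; rewrite ?u0 ?v0.
Qed.

End CopulaInterior.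

Section IntegralTransform.
Context d (T : measurableType d) (R : realType) (P : probability T R).
Local Notation pr := (pr P).
Variable X : {RV P >-> R}.
Hypothesis cX : continuous (cdf X).
Local Notation F x := (fine (cdf X x)).

Lemma fine_cdf_mono x y : x <= y -> F x <= F y.
Proof.
by move=> xy; rewrite !cdfE; apply: le_pr;
  [exact: measurable_RV_le|exact: measurable_RV_le|move=> w /= /le_trans;
    exact].
Qed.

Lemma fine_cdf_bounds x : 0 <= F x <= 1.
Proof. by rewrite /= cdfE pr_ge0/= pr_le1//; exact: measurable_RV_le. Qed.

Lemma measurable_fine_cdf : measurable_fun setT (fun w => F (X w)).
Proof.
have /measurable_EFinP h : measurable_fun setT (EFin \o (fun x => F x)).
  apply: eq_measurable_fun (cdf_measurable X) => x _ /=.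
  by rewrite fineK ?fin_num_measure.
exact: (measurableT_comp h).
Qed.

Let mF u : measurable [set w | F (X w) <= u].
Proof. exact/measurable_set_le/measurable_fine_cdf. Qed.

(** [F] may be flat to the right of [x], so [F (X w) <= F x] does not give [X w <= x]. It does give
    [X w < q] for each [q] with [F q] above [F x]; [p] is kept below 1 so that it is a value of
    [F]. *)
Lemma pr_fine_cdf x : pr [set w | F (X w) <= F x] = F x.
Proof.
apply/eqP; rewrite eq_le; apply/andP; split; last first.
  rewrite [leLHS]cdfE; apply: le_pr => //; first exact: measurable_RV_le.
  by move=> w /= /fine_cdf_mono.
have /andP[F0 F1'] := fine_cdf_bounds x.
have [F1|F1] := ltP (F x) 1; last by apply: le_trans F1; exact: pr_le1.
apply/ler_addgt0Pr => e e0.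
pose p := F x + Num.min e ((1 - F x) / 2).
have pF : F x < p < 1 /\ p <= F x + e.
  rewrite /p; move: F1; set y := F x => y1.
  have : Num.min e ((1 - y) / 2) <= e by rewrite ge_min lexx.
  have : Num.min e ((1 - y) / 2) <= (1 - y) / 2 by rewrite ge_min lexx orbT.
  have : 0 < Num.min e ((1 - y) / 2) by rewrite lt_min e0/=; lra.
  lra.
have [/andP[xp p1] pe] := pF.
have [q Fq] : exists q, F q = p.
  by apply: cdf_surj => //; rewrite p1 (le_lt_trans F0 xp).
apply: le_trans pe; rewrite -Fq [leRHS]cdfE; apply: le_pr => //.
  exact: measurable_RV_le.
move=> w /= Fw; rewrite leNgt; apply/negP => /ltW/fine_cdf_mono.
by rewrite /= Fq leNgt (le_lt_trans Fw xp).
Qed.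

Lemma pr_integral_transform u : 0 <= u <= 1 -> pr [set w | F (X w) <= u] = u.
Proof.
move=> /andP[u0 u1].
have inner v : 0 < v < 1 -> pr [set w | F (X w) <= v] = v.
  by move=> /(cdf_surj cX)[q <-]; exact: pr_fine_cdf.
have [u1'|] := ltP u 1; last first.
  move=> u1'; have -> : u = 1 by apply/eqP; rewrite eq_le u1.
  rewrite -[RHS](prT P); congr (pr _); apply/seteqP; split => // w _ /=.
  by have /andP[] := fine_cdf_bounds (X w).
move: u0; rewrite le_eqVlt => /orP[/eqP <-|u0]; last by rewrite inner ?u0.
(* The level 0 need not be a value of [F]; it is approached by small positive levels. *)
apply/eqP; rewrite eq_le pr_ge0 andbT; apply/ler_addgt0Pr => e e0.
pose p := Num.min e 2^-1.
have p0 : 0 < p by rewrite lt_min e0/=.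
have p2 : p <= 2^-1 by rewrite ge_min lexx orbT.
have pe : p <= e by rewrite ge_min lexx.
rewrite add0r (le_trans _ pe)// -[leRHS]inner; last by lra.
by apply: le_pr => // w /= /le_trans; apply; exact: ltW.
Qed.

End IntegralTransform.

Section Sklar.
Context d (T : measurableType d) (R : realType) (P : probability T R).
Local Notation pr := (pr P).

Lemma uniform_law (f : {mfun T >-> R}) :
  (forall u, 0 <= u <= 1 -> pr [set w | f w <= u] = u) ->
  forall A, measurable A ->
    distribution P f A = uniform_prob (@ltr01 R) A.
Proof.
move=> fu.
have mi : @measurable_fun _ _ (measurableTypeR R) R setT idfun.
  exact: measurable_id.
(* [uniform_prob] lives on another copy of the Borel sigma-algebra of [R] *)
pose i : {mfun measurableTypeR R >-> R} :=
  @mfun_Sub _ _ (measurableTypeR R) R idfun (mem_set mi).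
refine (@measure_eq_cdf _ (distribution P f)
  (distribution (uniform_prob (@ltr01 R)) i) _) => x.
rewrite -[RHS]/(uniform_prob (@ltr01 R) `]-oo, x]%classic).
have e (y : R) : 0 <= y <= 1 ->
    distribution P f `]-oo, y]%classic =
      uniform_prob (@ltr01 R) `]-oo, y]%classic.
  move=> y01; rewrite uniform_prob_ray// -[in RHS](fu y y01) -prE.
    by congr (P _).
  exact: measurable_set_le.
have mono d' (S : measurableType d') (m : probability S R) (A B : set S) :
    measurable A -> measurable B -> A `<=` B -> (m A <= m B)%E.
  by move=> mA mB AB; rewrite le_measure ?inE.
have eqle (a b : \bar R) : a = b -> (a <= b)%E by move->.
have h0 : 0 <= (0 : R) <= 1 by rewrite lexx ler01.
have h1 : 0 <= (1 : R) <= 1 by rewrite lexx ler01.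
have [x0|x0] := leP x 0.
  have sub : `]-oo, x] `<=` `]-oo, (0 : R)] by exact: subitvPr.
  have := mono _ _ (distribution P f) _ _ (measurable_itv _) (measurable_itv
    _) sub.
  have := mono _ _ (uniform_prob (@ltr01 R)) _ _ (measurable_itv _)
    (measurable_itv _) sub.
  move=> /le_trans/(_ (eqle _ _ (uniform_prob_ray h0))) u0.
  move=> /le_trans/(_ (eqle _ _ (etrans (e 0 h0) (uniform_prob_ray h0)))) f0.
  by apply: (@eq_trans _ _ 0%E); [|symmetry]; apply/eqP;
    rewrite eq_le measure_ge0 andbT.
have [x1|x1] := leP x 1; first by apply: e; rewrite (ltW x0).
have sub : `]-oo, (1 : R)] `<=` `]-oo, x] by apply: subitvPr;
  rewrite bnd_simp ltW.
have := mono _ _ (distribution P f) _ _ (measurable_itv _) (measurable_itv _)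
  sub.
have := mono _ _ (uniform_prob (@ltr01 R)) _ _ (measurable_itv _)
  (measurable_itv _) sub.
move=> /(le_trans (eqle _ _ (esym (uniform_prob_ray h1)))) u1.
move=> /(le_trans (eqle _ _ (esym (etrans (e 1 h1) (uniform_prob_ray h1))))) f1.
apply: (@eq_trans _ _ 1%E); [|symmetry]; apply/eqP; rewrite eq_le.
  by rewrite f1 andbT; exact: probability_le1.
by rewrite u1 andbT; exact: probability_le1.
Qed.

(** The copula is the joint distribution function of [(F X, F Y)]. The event [X <= x] is contained
    in [F X <= F x], perhaps strictly where [F] is flat, but the difference is null. *)
Lemma copula_exists (X Y : {RV P >-> R}) : continuous (cdf X) ->
  eq_in_law X Y -> exists C, is_copula_of C X Y.
Proof.
move=> cX XY.
have cdfXY : cdf X = cdf Y by apply/funext => x; rewrite /cdf XY.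
have cY : continuous (cdf Y) by rewrite -cdfXY.
pose F x := fine (cdf X x).
have mFX : measurable_fun setT (fun w => F (X w)) by exact: measurable_fine_cdf.
have mFY : measurable_fun setT (fun w => F (Y w)).
  by rewrite /F cdfXY; exact: measurable_fine_cdf.
pose fX : {mfun T >-> R} := mfun_Sub (mem_set mFX).
pose fY : {mfun T >-> R} := mfun_Sub (mem_set mFY).
have uX u : 0 <= u <= 1 -> pr [set w | fX w <= u] = u.
  exact: pr_integral_transform.
have uY u : 0 <= u <= 1 -> pr [set w | fY w <= u] = u.
  rewrite /= /F cdfXY; exact: pr_integral_transform.
have mZ : measurable_fun setT (fun w => (F (X w), F (Y w))).
  exact: measurable_fun_pair.
pose Z : {mfun T >-> (R * R)%type} := mfun_Sub (mem_set mZ).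
pose C u v := pr ([set w | F (X w) <= u] `&` [set w | F (Y w) <= v]).
have mX u : measurable [set w | F (X w) <= u] by exact: measurable_set_le.
have mY u : measurable [set w | F (Y w) <= u] by exact: measurable_set_le.
have CC : copula C.
  exists (distribution P Z); split.
  - by move=> A mA; rewrite -(uniform_law uX).
  - by move=> A mA; rewrite -(uniform_law uY).
  - move=> u v; rewrite -prE; last exact: measurableI.
    by congr (P _).
exists C; split => // x y.
have mX' : measurable [set w | X w <= x] by exact: measurable_RV_le.
have mY' : measurable [set w | Y w <= y] by exact: measurable_RV_le.
rewrite -cdfXY -/(F x) -/(F y).
transitivity ((pr ([set w | X w <= x] `&` [set w | Y w <= y]))%:E).
  by rewrite -prE//; exact: measurableI.
congr EFin; apply/eqP; rewrite eq_le /C.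
have sX : [set w | X w <= x] `<=` [set w | F (X w) <= F x].
  by move=> w /= /(fine_cdf_mono X).
have sY : [set w | Y w <= y] `<=` [set w | F (Y w) <= F y].
  by move=> w /= /(fine_cdf_mono X).
apply/andP; split.
  by apply: le_pr; [exact: measurableI|exact: measurableI|exact: setISS].
have eX : pr ([set w | F (X w) <= F x] `\` [set w | X w <= x]) = 0.
  rewrite prDs// [X in X - _](pr_fine_cdf cX) /F cdfE subrr//.
have eY : pr ([set w | F (Y w) <= F y] `\` [set w | Y w <= y]) = 0.
  rewrite prDs// /F cdfXY [X in X - _](pr_fine_cdf cY) cdfE subrr//.
pose D := ([set w | F (X w) <= F x] `\` [set w | X w <= x]) `|`
   ([set w | F (Y w) <= F y] `\` [set w | Y w <= y]).
have mD : measurable D by apply: measurableU; exact: measurableD.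
have D0 : pr (~` ~` D) = 0.
  have mDX := measurableD (mX (F x)) mX';
    have mDY := measurableD (mY (F y)) mY'.
  rewrite setCK /D /pr measureU0//; exact: pr_null.
rewrite -(pr_setI_full _ (measurableC mD) D0); last exact: measurableI.
apply: le_pr.
- by apply: measurableI; [exact: measurableI|exact: measurableC].
- exact: measurableI.
move=> w [[/= FX FY] nD]; split; apply: contrapT => h; apply: nD.
  by left.
by right.
Qed.

End Sklar.

(** * Looping motions *)

Section TriangleWave.
Variable R : realType.
Implicit Types x y h : R.

Definition frac y : R := y - (Num.floor y)%:~R.

Lemma frac_itv y : 0 <= frac y < 1.
Proof.
rewrite /frac subr_ge0 floor_le/= ltrBlDl.
by have := floorD1_gt y; rewrite intrD.
Qed.

Lemma frac_unique y f (z : int) : y = z%:~R + f -> 0 <= f < 1 -> frac y = f.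
Proof.
move=> yE /andP[f0 f1]; rewrite /frac (@floor_def _ _ z).
  by rewrite yE addrC addKr.
by rewrite yE intrD lerDl f0 ltrD2l.
Qed.

(** Triangle wave of period 1, equal to 1 at the integers and to 0 half-way between them. *)
Definition tri y : R := `|2 * frac y - 1|.

(** Periodicity in the form met in [pos_rot], where the leading 1 comes from the left end of a
    block. *)
Lemma tri_frac y h : tri (1 + frac y + h) = tri (y + h).
Proof.
rewrite /tri (@frac_unique _ (frac (y + h))
  (1 + Num.floor (y + h) - Num.floor y)) ?frac_itv//.
rewrite /frac !intrD mulrNz; ring.
Qed.

Lemma tri_itv y : 0 <= tri y <= 1.
Proof.
rewrite /tri normr_ge0/= ler_norml; have := frac_itv y; lra.
Qed.

Lemma tri_half y : tri (y + 2^-1) = 1 - tri y.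
Proof.
have yE : y = (Num.floor y)%:~R + frac y by rewrite /frac addrC subrK.
have := frac_itv y; rewrite /tri => fy.
have [f2|f2] := ltP (frac y) 2^-1.
  rewrite (@frac_unique _ (frac y + 2^-1) (Num.floor y)); [|lra|lra].
  rewrite ger0_norm ?ler0_norm; lra.
rewrite (@frac_unique _ (frac y - 2^-1) (Num.floor y + 1)); [|rewrite intrD;
  lra|lra].
rewrite ler0_norm ?ger0_norm; lra.
Qed.

(** If [y + h] passes an integer, then [h <= 2^-1] puts [frac y] in the upper half and
    [frac (y + h)] in the lower one, which fixes the signs of both absolute values. *)
Lemma tri_lip y h : 0 <= h <= 2^-1 -> `|tri (y + h) - tri y| <= 2 * h.
Proof.
move=> h0.
have yE : y = (Num.floor y)%:~R + frac y by rewrite /frac addrC subrK.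
have fy := frac_itv y; rewrite /tri.
have [f1|f1] := ltP (frac y + h) 1.
  rewrite (@frac_unique _ (frac y + h) (Num.floor y)); [|lra|lra].
  rewrite (le_trans (ler_dist_dist _ _))// ler_norml; lra.
rewrite (@frac_unique _ (frac y + h - 1) (Num.floor y + 1)); [|rewrite intrD;
  lra|lra].
rewrite [X in `|X - _|]ler0_norm; last by lra.
rewrite [X in `|_ - X|]ger0_norm; last by lra.
rewrite ler_norml; lra.
Qed.

Lemma tri_12 y : 1 <= y < 2 -> tri y = `|2 * y - 3|.
Proof.
move=> y12; rewrite /tri (@frac_unique _ (y - 1) 1); [|lra|lra].
by congr `|_|; lra.
Qed.

Lemma measurable_frac : measurable_fun setT frac.
Proof.
apply: measurable_funB => //.
apply: nondecreasing_measurable => // x y xy.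
by rewrite ler_int le_floor.
Qed.

Lemma measurable_tri : measurable_fun setT tri.
Proof.
apply: measurableT_comp => //; apply: measurable_funB => //.
by apply: measurable_funM => //; exact: measurable_frac.
Qed.

End TriangleWave.

(** * Loops carried by the dyadic blocks of the unit interval *)

Section Loops.
Variable R : realType.
Implicit Types (x y : R) (al be : nat -> R).

(** Left end of the dyadic block [[low k, 2 * low k[]; these blocks partition []0, 1[]. *)
Definition low k : R := 2^-1 ^+ k.+1.

Lemma low_gt0 k : 0 < low k.
Proof. exact: exprn_gt0. Qed.

Lemma lowS k : low k = 2 * low k.+1.
Proof. rewrite /low [in RHS]exprS; lra. Qed.

Lemma low0 : low 0 = 2^-1.
Proof. by rewrite /low expr1. Qed.

Lemma low_le j k : (j <= k)%N -> low k <= low j.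
Proof.
by move=> jk; rewrite /low ler_wiXn2l//; lra.
Qed.

Lemma low_lt j k : (j < k)%N -> 2 * low k <= low j.
Proof. by move=> jk; rewrite (lowS j); have := low_le jk; lra. Qed.

Lemma low_le_half k : low k <= 2^-1.
Proof. by rewrite -low0; exact: low_le. Qed.

(* outside ]0, 1[ the block index is the junk value 0 *)
Lemma block_ex x : exists k,
  if 0 < x < 1 then low k <= x < 2 * low k else k == 0%N.
Proof.
case: (boolP (0 < x < 1)) => [/andP[x0 x1]|_]; last by exists 0%N.
have ex : exists k, low k <= x.
  exists (Num.bound x^-1); rewrite /low exprVn -[leRHS]invrK.
  rewrite lef_pV2 ?posrE ?invr_gt0 ?exprn_gt0//.
  by apply: ltW; apply: upper_nthrootP.
case: (ex_minnP ex) => -[|k] kx kmin.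
  by exists 0%N; move: kx; rewrite low0; lra.
exists k.+1; rewrite kx -lowS ltNge /=; apply/negP => /kmin.
by rewrite ltnn.
Qed.

Definition block x : nat := projT1 (cid (block_ex x)).

Lemma blockP x : 0 < x < 1 -> low (block x) <= x < 2 * low (block x).
Proof. by move=> x01; rewrite /block; case: cid => k /=; rewrite x01. Qed.

Lemma block_out x : ~~ (0 < x < 1) -> block x = 0%N.
Proof. by move=> x01; rewrite /block; case: cid => k /=;
  rewrite (negbTE x01) => /eqP. Qed.

Lemma block_unique x k : low k <= x < 2 * low k -> block x = k.
Proof.
move=> xk.
have x01 : 0 < x < 1.
  by have := low_gt0 k; have := low_le_half k; lra.
have xb := blockP x01.
by have [h|h|//] := ltngtP (block x) k; exfalso; have {h} := low_lt h; lra.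
Qed.

Lemma block_preimage k : block @^-1` [set k] =
  `[low k, 2 * low k[%classic `|` (if k == 0%N then ~` `]0, 1[%classic else
    set0).
Proof.
apply/seteqP; split => x /=.
  have [x01|x01] := boolP (0 < x < 1).
    by move=> <-; left; rewrite /= in_itv/=; exact: blockP.
  rewrite block_out// => <-; right.
  by rewrite eqxx /= in_itv/=; apply/negP.
rewrite in_itv/= => -[|]; first exact: block_unique.
case: eqP => [-> /= |//]; rewrite in_itv /= => /negP x01.
exact: block_out.
Qed.

Lemma measurable_block k : measurable (block @^-1` [set k]).
Proof.
rewrite block_preimage; apply: measurableU; first exact: measurable_itv.
by case: ifP => // _; apply: measurableC; exact: measurable_itv.
Qed.

Lemma measurable_blockwise (h : nat -> R -> R) :
  (forall k, measurable_fun setT (h k)) ->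
  measurable_fun setT (fun x => h (block x) x).
Proof.
move=> mh _ A mA; rewrite setTI.
rewrite (_ : _ @^-1` _ =
    \bigcup_k (block @^-1` [set k] `&` h k @^-1` A)).
  apply: bigcup_measurable => k _; apply: measurableI.
    exact: measurable_block.
  by rewrite -[X in measurable X]setTI; exact: mh.
apply/seteqP; split => [x /= hx|x [k _ [/= <-]]//].
by exists (block x).
Qed.

(** Each block is seen as a circle and turned by the fraction [al k] of its length. *)
Definition rot al x : R :=
  low (block x) * (1 + frac (x / low (block x) + al (block x))).

Lemma block_rot al x : 0 < x < 1 -> block (rot al x) = block x.
Proof.
move=> x01; apply: block_unique; rewrite /rot.
have := frac_itv (x / low (block x) + al (block x)).
have := low_gt0 (block x); set l := low _; set f := frac _ => l0 /andP[f0 f1].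
by rewrite ler_pMr// lerDl f0/= [2 * l]mulrC ltr_pM2l//; lra.
Qed.

Lemma rot_itv al x : 0 < x < 1 ->
  low (block x) <= rot al x < 2 * low (block x).
Proof.
move=> x01; rewrite /rot.
have := frac_itv (x / low (block x) + al (block x)).
have := low_gt0 (block x); set l := low _; set f := frac _ => l0 /andP[f0 f1].
by rewrite ler_pMr// lerDl f0/= [2 * l]mulrC ltr_pM2l//; lra.
Qed.

Lemma rot_01 al x : 0 < x < 1 -> 0 < rot al x < 1.
Proof.
move=> x01; have := rot_itv al x01.
have := low_gt0 (block x); have := low_le_half (block x); lra.
Qed.

Lemma measurable_rot al : measurable_fun setT (rot al).
Proof.
apply: (@measurable_blockwise (fun k x => low k * (1 + frac (x / low k +
  al k)))).
move=> k; apply: measurable_funM => //; apply: measurable_funD => //.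
apply: measurableT_comp; first exact: measurable_frac.
by apply: measurable_funD => //; apply: measurable_funM.
Qed.

(* On the loop [k] the motion runs back and forth over [edge k, 1 - edge k]. *)
Definition edge k : R := low k.+1.

Definition pos al x : R :=
  edge (block x) +
  (1 - 2 * edge (block x)) * tri (x / low (block x) + al (block x)).

Lemma edge_bounds k : 0 < edge k <= 4^-1.
Proof.
rewrite low_gt0/= (le_trans (low_le (leq_addr k 1)))// /low.
by rewrite expr2; lra.
Qed.

Lemma measurable_pos al : measurable_fun setT (pos al).
Proof.
apply: (@measurable_blockwise
  (fun k x => edge k + (1 - 2 * edge k) * tri (x / low k + al k))).
move=> k; apply: measurable_funD => //; apply: measurable_funM => //.
apply: measurableT_comp; first exact: measurable_tri.
by apply: measurable_funD => //; apply: measurable_funM.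
Qed.

Lemma pos_itv al x : edge (block x) <= pos al x <= 1 - edge (block x).
Proof.
rewrite /pos; have := tri_itv (x / low (block x) + al (block x)).
have := edge_bounds (block x); set e := edge _; set t := tri _ => e0 t0.
nra.
Qed.

(** A rotation of the point amounts to a shift of the phase, so invariance of a law under [rot]
    becomes stationarity of the motion. *)
Lemma pos_rot al be x : 0 < x < 1 ->
  pos be (rot al x) = pos (fun k => al k + be k) x.
Proof.
move=> x01; rewrite /pos block_rot// /rot.
rewrite [low _ * _]mulrC mulfK ?gt_eqF ?low_gt0//.
by rewrite tri_frac addrA.
Qed.

Lemma pos_half al x : pos (fun k => al k + 2^-1) x = 1 - pos al x.
Proof. by rewrite /pos addrA tri_half; ring. Qed.

Lemma pos_lip al be x : (forall k, 0 <= be k <= 2^-1) ->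
  `|pos (fun k => al k + be k) x - pos al x| <= 2 * be (block x).
Proof.
move=> be0; rewrite /pos addrA.
have := @tri_lip R (x / low (block x) + al (block x)) (be (block x)) (be0 _).
have := edge_bounds (block x); set e := edge _; set t := tri _; set t' := tri _.
move=> e0 tt; rewrite opprD addrACA subrr add0r -mulrBr normrM.
rewrite (le_trans _ tt)// ler_piMl// ger0_norm; lra.
Qed.

End Loops.

(** * Law and stationarity of the motion started from a uniform variable *)

Section LoopLaw.
Context d (T : measurableType d) (R : realType) (P : probability T R).
Local Notation pr := (pr P).
Variable U : T -> R.
Hypothesis mU : measurable_fun setT U.
Hypothesis U01 : forall w, 0 < U w < 1.
Hypothesis prU_le : forall x, 0 <= x <= 1 -> pr [set w | U w <= x] = x.

Let mle x : measurable [set w | U w <= x].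
Proof. exact: measurable_set_le. Qed.

Let mlt x : measurable [set w | U w < x].
Proof. exact: measurable_set_lt. Qed.

Lemma pr_U_lt x : 0 <= x <= 1 -> pr [set w | U w < x] = x.
Proof.
move=> /andP[x0 x1]; apply/eqP; rewrite eq_le; apply/andP; split.
  rewrite -[leRHS]prU_le ?x0//; apply: le_pr => // w /=; exact: ltW.
apply/ler_addgt0Pr => e e0.
have [xe|xe] := leP x e.
  by rewrite (le_trans xe)// lerDr pr_ge0.
rewrite -lerBlDr -[leLHS]prU_le; last by lra.
apply: le_pr => // w /= /le_lt_trans; apply; lra.
Qed.

Lemma pr_U_cc s t : 0 <= s -> s <= t -> t <= 1 ->
  pr [set w | s <= U w <= t] = t - s.
Proof.
move=> s0 st t1.
rewrite -[X in X - _]prU_le ?(le_trans s0 st)// -[X in _ - X]pr_U_lt;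
  last first.
  by rewrite s0 (le_trans st).
rewrite -prDs//.
  congr (pr _); apply/seteqP; split => w /=.
    by move=> /andP[sU Ut]; split => //; rewrite ltNge sU.
  by move=> [-> /negP]; rewrite -leNgt => ->.
by move=> w /= /ltW /le_trans; apply.
Qed.

Lemma pr_U_co s t : 0 <= s -> s <= t -> t <= 1 ->
  pr [set w | s <= U w < t] = t - s.
Proof.
move=> s0 st t1.
rewrite -[X in X - _]pr_U_lt ?(le_trans s0 st)// -[X in _ - X]pr_U_lt;
  last first.
  by rewrite s0 (le_trans st).
rewrite -prDs//.
  congr (pr _); apply/seteqP; split => w /=.
    by move=> /andP[sU Ut]; split => //; rewrite ltNge sU.
  by move=> [-> /negP]; rewrite -leNgt => ->.
by move=> w /= /lt_le_trans; apply.
Qed.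

Lemma measurable_U_cc s t : measurable [set w | s <= U w <= t].
Proof.
rewrite (_ : mkset _ = [set w | U w <= t] `\` [set w | U w < s]).
  exact: measurableD.
apply/seteqP; split => w /=.
  by move=> /andP[sU ->]; split => //; rewrite ltNge sU.
by move=> [-> /negP]; rewrite -leNgt => ->.
Qed.

Lemma measurable_U_co s t : measurable [set w | s <= U w < t].
Proof.
rewrite (_ : mkset _ = [set w | U w < t] `\` [set w | U w < s]).
  exact: measurableD.
apply/seteqP; split => w /=.
  by move=> /andP[sU ->]; split => //; rewrite ltNge sU.
by move=> [-> /negP]; rewrite -leNgt => ->.
Qed.

Lemma pr_U_eq t : pr [set w | U w = t] = 0.
Proof.
have [/andP[t0 t1]|] := boolP (0 <= t <= 1).
  rewrite -[RHS](subrr t) -(pr_U_cc t0 (lexx t) t1); congr (pr _).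
  apply/seteqP; split => w /=; first by move=> ->; rewrite lexx.
  by move=> h; apply/eqP; rewrite eq_le andbC.
rewrite negb_and -!ltNge => t01; rewrite -[RHS](pr0 P); congr (pr _).
by apply/seteqP; split => w //= Ut; have := U01 w; move: t01; rewrite Ut; lra.
Qed.

Let mrot al : measurable_fun setT (fun w => rot al (U w)).
Proof. by apply: measurableT_comp => //; exact: measurable_rot. Qed.

(** A rotation keeps each block, so only the block of [x] matters. There it is a translation by
    [l * f], wrapped around, and the preimage of [[l, x]] is made of at most two intervals of total
    length [x - l]. *)
Lemma pr_rot_U al x : pr [set w | rot al (U w) <= x] = pr [set w | U w <= x].
Proof.
have [x0|x0] := leP x 0.
  congr (pr _); apply/seteqP; split => w /=.
    by have := rot_01 al (U01 w); lra.
  by have := U01 w; lra.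
have [x1|x1] := leP 1 x.
  congr (pr _); apply/seteqP; split => w /= _.
    by have := U01 w; lra.
  by have := rot_01 al (U01 w); lra.
have x01 : 0 < x < 1 by rewrite x0.
rewrite prU_le; last by rewrite !ltW.
pose k := block x; pose l : R := low R k; pose f := frac (al k).
have l0 : 0 < l by exact: low_gt0.
have lh : l <= 2^-1 by exact: low_le_half.
have xk : l <= x < 2 * l by exact: blockP.
have f01 : 0 <= f < 1 by exact: frac_itv.
have fE : al k = (Num.floor (al k))%:~R + f by rewrite /f /frac addrC subrK.
have lf : 0 <= l * f < l.
  move: f01 => /andP[f0 f1]; apply/andP; split.
    by rewrite mulr_ge0// ltW.
  by rewrite gtr_pMr.
have other w : ~~ (l <= U w < 2 * l) -> (rot al (U w) <= x) = (U w < l).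
  move=> nk; have bU := blockP (U01 w); have rU := rot_itv al (U01 w).
  have [kj|jk|jk] := ltngtP k (block (U w)).
  - have := low_lt R kj; rewrite -/l => h.
    have -> : U w < l by lra.
    lra.
  - have := low_lt R jk; rewrite -/l => h.
    have -> : U w < l = false by lra.
    lra.
  - by move: nk; rewrite /l jk bU.
have inside w : l <= U w < 2 * l -> rot al (U w) =
    if U w + l * f < 2 * l then U w + l * f else U w + l * f - l.
  move=> h; have bU := block_unique h; rewrite /rot bU -/l fE.
  pose y := U w / l; have [y1 y2] : 1 <= y /\ y < 2.
    by rewrite /y ler_pdivlMr// ltr_pdivrMr// mul1r; move: h => /andP[-> ->].
  have UE : U w = l * y by rewrite mulrC divfK ?gt_eqF.
  rewrite -/y UE -mulrDr [2 * l]mulrC ltr_pM2l//; case: ltP => yf.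
    rewrite (@frac_unique _ _ (y + f - 1) (Num.floor (al k) + 1)).
    - by rewrite addrC subrK.
    - by rewrite intrD; ring.
    - move: f01; lra.
  rewrite (@frac_unique _ _ (y + f - 2) (Num.floor (al k) + 2)).
  - ring.
  - by rewrite intrD; ring.
  - move: f01; lra.
(* [l + l * f] is the image of the left end of the block: from there on the preimage consists of an
   initial and a final piece of the block, before it of one interval. *)
have [xf|xf] := leP (l + l * f) x.
  rewrite (_ : mkset _ = [set w | U w <= x - l * f] `|`
      [set w | 2 * l - l * f <= U w < 2 * l]).
    rewrite prU//.
    - rewrite prU_le ?pr_U_co; lra.
    - exact: measurable_U_co.
    - rewrite disj_set2E; apply/eqP/seteqP; split => // w [/=]; lra.
  apply/seteqP; split => w /=.
    have [h|h] := boolP (l <= U w < 2 * l).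
      rewrite inside//; case: ifPn; rewrite -?leNgt => h1 h2; [left|right]; lra.
    rewrite other// => h1; left; lra.
  have [h|h] := boolP (l <= U w < 2 * l).
    rewrite inside//; case: ifPn; rewrite -?leNgt => h1 []; lra.
  rewrite other// => -[]; lra.
rewrite (_ : mkset _ = [set w | U w < l] `|`
    [set w | 2 * l - l * f <= U w <= x + l - l * f]).
  rewrite prU//.
  - rewrite pr_U_lt ?pr_U_cc; lra.
  - exact: measurable_U_cc.
  - rewrite disj_set2E; apply/eqP/seteqP; split => // w [/=]; lra.
apply/seteqP; split => w /=.
  have [h|h] := boolP (l <= U w < 2 * l).
    rewrite inside//; case: ifPn; rewrite -?leNgt => h1 h2; [exfalso|right];
      lra.
  by rewrite other//; left.
have [h|h] := boolP (l <= U w < 2 * l).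
  rewrite inside//; case: ifPn; rewrite -?leNgt => h1 []; lra.
rewrite other// => -[]; lra.
Qed.

Lemma rot_law al (A : set R) : measurable A ->
  P [set w | A (rot al (U w))] = P [set w | A (U w)].
Proof.
pose r : {mfun T >-> R} := mfun_Sub (mem_set (mrot al)).
pose u : {mfun T >-> R} := mfun_Sub (mem_set mU).
apply: (@measure_eq_cdf _ (distribution P r) (distribution P u)) => x.
transitivity ((pr [set w | rot al (U w) <= x])%:E).
  by rewrite -prE; [congr (P _)|exact: measurable_set_le].
by rewrite pr_rot_U -prE.
Qed.

(** The phases [al] and [be] differ by a rotation by [al k - be k], under which the law of [U] is
    invariant. *)
Lemma pos_law al be (A : set R) : measurable A ->
  P [set w | A (pos al (U w))] = P [set w | A (pos be (U w))].
Proof.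
move=> mA.
have -> : [set w | A (pos al (U w))] =
    [set w | (pos be @^-1` A) (rot (fun k => al k - be k) (U w))].
  apply/seteqP; split => w /=; rewrite pos_rot//;
    by rewrite (_ : (fun k => _) = al)//; apply/funext => k; rewrite subrK.
rewrite (@rot_law _ (pos be @^-1` A))// -[X in measurable X]setTI.
exact: (measurable_pos be measurableT mA).
Qed.

(** Rotating by [al] removes the common phase; thus the joint law of a pair depends only on the
    phase difference. *)
Lemma pos_law2 al be x y :
  pr ([set w | pos al (U w) <= x] `&` [set w | pos (fun k => al k +
    be k) (U w) <= y]) =
  pr ([set w | pos (fun=> 0) (U w) <= x] `&` [set w | pos be (U w) <= y]).
Proof.
pose A := [set z : R | pos (fun=> 0) z <= x] `&` [set z : R | pos be z <= y].
have mA : measurable A.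
  by apply: measurableI; apply: measurable_set_le; exact: measurable_pos.
rewrite /pr -[in RHS](@rot_law al A mA); congr (fine (P _)).
have a0 : (fun k => al k + 0) = al by apply/funext => k; rewrite addr0.
by apply/seteqP; split => w /=; rewrite /A /= !pos_rot// a0.
Qed.

Definition walk al : {RV P >-> R} :=
  mfun_Sub (mem_set (measurableT_comp (measurable_pos al) mU)).

Lemma walkE al w : walk al w = pos al (U w).
Proof. by []. Qed.

Lemma walk_law al be : eq_in_law (walk al) (walk be).
Proof. by move=> A mA; exact: (pos_law al be mA). Qed.

Lemma walk_01 al w : 0 < walk al w < 1.
Proof.
rewrite walkE; have := pos_itv al (U w).
have := edge_bounds R (block (U w)); lra.
Qed.

Lemma pos0E w (k := block (U w)) :
  pos (fun=> 0) (U w) = edge R k +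
    (1 - 2 * edge R k) * `|2 * (U w / low R k) - 3|.
Proof.
rewrite /pos addr0 tri_12//.
have := blockP (U01 w); have := low_gt0 R (block (U w)); set l := low _ _ => l0.
by rewrite ler_pdivlMr// ltr_pdivrMr// mul1r.
Qed.

Lemma pr_walk_eq al x : pr [set w | walk al w = x] = 0.
Proof.
have -> : pr [set w | walk al w = x] = pr [set w | pos (fun=> 0) (U w) = x].
  by congr fine; exact: (pos_law al (fun=> 0) (measurable_set1 x)).
(* [t k s] solves the formula of [pos0E] for [U w] on block [k], with [s] the sign inside the
   absolute value: two solutions per block, hence countably many in all. *)
pose t (k : nat) (s : R) :=
  low R k * (3 + s * ((x - edge R k) / (1 - 2 * edge R k))) / 2.
pose N := \bigcup_k ([set w | U w = t k 1] `|` [set w | U w = t k (-1)]).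
have mEq (y : R) : measurable [set w | U w = y].
  rewrite (_ : mkset _ = [set w | y <= U w <= y]); first exact: measurable_U_cc.
  apply/seteqP; split => w /=; first by move=> ->; rewrite lexx.
  by move=> h; apply/eqP; rewrite eq_le andbC.
have mN : measurable N by apply: bigcup_measurable => k _; exact: measurableU.
have N0 : P N = 0%E.
  apply/negligibleP => //; apply: negligible_bigcup => k.
  by apply: negligibleU; apply/negligibleP => //; apply: pr_null => //;
    exact: pr_U_eq.
apply/eqP; rewrite eq_le pr_ge0 andbT -[leRHS](_ : pr N = 0);
  last by rewrite /pr N0.
apply: le_pr => //.
  have := measurable_pos (fun=> 0) measurableT (measurable_set1 x).
  by rewrite setTI => /(mU measurableT); rewrite setTI.
move=> w /=; rewrite pos0E; set k := block _ => xE; exists k => //.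
have := edge_bounds R k; have := low_gt0 R k.
move: xE; rewrite /t; set l := low _ _; set e := edge _ _ => <- l0 e0.
have e1 : 1 - 2 * e != 0 by rewrite gt_eqF//; lra.
have -> A : (e + (1 - 2 * e) * A - e) / (1 - 2 * e) = A.
  by rewrite addrAC subrr add0r mulrC mulKf.
have [h|h] := leP 0 (2 * (U w / l) - 3).
  left; rewrite /= ger0_norm//; field; rewrite gt_eqF//.
right; rewrite /= ltr0_norm//; field; rewrite gt_eqF//.
Qed.

Lemma walk_Linfty al : (walk al : T -> R) \in Lfun P +oo%E.
Proof.
rewrite inE; apply/andP; split; first by rewrite inE; exact: measurable_funPT.
rewrite inE /= /finite_norm unlock /=.
have -> : (0 < P setT)%E by rewrite probability_setT.
apply: (@le_lt_trans _ _ 1%E); last exact: ltry.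
apply/ess_supP; apply: aeW => w /=; rewrite lee_fin.
by have /= := walk_01 al w; rewrite ler_norml; lra.
Qed.

Lemma walk_L1 al : (walk al : T -> R) \in Lfun P 1.
Proof.
apply: (@Lfun_subset _ _ _ P 1 +oo%E) (walk_Linfty al); rewrite ?leey//.
exact: fin_num_measure.
Qed.

(* half a turn exchanges the two ends of each loop *)
Lemma walk_mean al : expectation P (walk al) = (2^-1)%:E.
Proof.
pose al' k : R := al k + 2^-1.
have e0 : expectation P (walk al') = expectation P (walk al).
  (* The absolute value, harmless for a positive walk, gives a nonnegative integrand for the change
     of variables. *)
  have ev be : expectation P (walk be) =
      (\int[distribution P (walk be)]_y `|y|%:E)%E.
    have mabs : measurable_fun [set: R] (fun y : R => `|y|%:E).
      by apply: measurableT_comp => //; exact: normr_measurable.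
    rewrite ge0_integral_distribution//.
    rewrite unlock; apply: eq_integral => w _ /=.
    by rewrite ger0_norm//; have /andP[/ltW] := walk_01 be w.
  rewrite !ev; apply: eq_measure_integral => A mA _.
  exact: (pos_law al' al mA).
have e1 : (walk al' : T -> R) = cst 1 \- walk al.
  by apply/funext => w; rewrite /= pos_half.
move: e0; rewrite e1 expectationB ?walk_L1//; last exact: Lfun_cst.
have fin := expectation_fin_num (walk_L1 al).
rewrite expectation_cst -(fineK fin) -EFinB => -[h].
congr EFin; lra.
Qed.

(** The increments of the cdf near [x] are bounded by the masses of the windows [G n], which shrink
    to the null event [walk al w = x]. *)
Lemma walk_cdf_continuous al : continuous (cdf (walk al)).
Proof.
move=> x.
have mle' y : measurable [set w | walk al w <= y] by exact: measurable_RV_le.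
pose G (n : nat) := [set w | walk al w <= x + n.+1%:R^-1] `\`
  [set w | walk al w <= x - n.+1%:R^-1].
have mG n : measurable (G n) by exact: measurableD.
have cvgG : pr (G n) @[n --> \oo] --> (0 : R).
  rewrite -(pr_walk_eq al x).
  have -> : [set w | walk al w = x] = \bigcap_n G n.
    apply/seteqP; split => w.
      move=> wx n _; split; rewrite /= -?walkE wx; first by rewrite lerDl.
      by apply/negP; rewrite -ltNge ltrBlDr ltrDl.
    move=> Gw; apply/eqP; rewrite eq_le !leNgt; apply/andP; split.
      apply/negP => /ltr_add_invr[n h].
      by have [/= + _] := Gw n I; rewrite leNgt h.
    apply/negP => /ltr_add_invr[n h].
    by have [_] := Gw n I; apply; rewrite /= lerBrDr ltW.
  apply: fine_cvg; rewrite -/(pr _) -prE; last exact: bigcapT_measurable.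
  apply: nonincreasing_cvg_mu.
  - by rewrite (le_lt_trans (probability_le1 P (mG _))) ?ltry.
  - exact: mG.
  - exact: bigcapT_measurable.
  - move=> n m nm; apply/subsetPset => w [/= h1 h2].
    have le : m.+1%:R^-1 <= n.+1%:R^-1 :> R.
      by rewrite lef_pV2 ?posrE// ler_nat.
    split => /=; first by rewrite (le_trans h1)// lerD2l.
    by move=> h; apply: h2; rewrite (le_trans h)// lerD2l lerN2.
have prG n : pr (G n) =
    fine (cdf (walk al) (x + n.+1%:R^-1)) - fine (cdf (walk al) (x -
      n.+1%:R^-1)).
  rewrite !cdfE prDs// => w /= /le_trans; apply.
  by rewrite lerD2l (@le_trans _ _ 0)// oppr_le0.
suff : cdf (walk al) y @[y --> x] --> (fine (cdf (walk al) x))%:E.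
  by rewrite fineK ?fin_num_measure.
apply: cvg_EFin; first by apply: nearW => y; rewrite fin_num_measure.
apply/cvgrPdist_lt => e e0.
have [n _ /(_ n (leqnn n))] := (cvgr_lt _ cvgG) _ e0.
have n0 : 0 < n.+1%:R^-1 :> R by rewrite invr_gt0.
rewrite /= prG; set c := n.+1%:R^-1 in n0 * => h.
near=> y.
have yn : `|x - y| < c.
  by near: y; apply: cvgr_dist_lt => //; exact: cvg_id.
have /andP[y1 y2] : x - c <= y <= x + c.
  by move: yn; rewrite ltr_norml; lra.
have := fine_cdf_mono (walk al) y1; have := fine_cdf_mono (walk al) y2.
have x1 : x - c <= x by rewrite gerBl ltW.
have x2 : x <= x + c by rewrite lerDl ltW.
have := fine_cdf_mono (walk al) x1; have := fine_cdf_mono (walk al) x2.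
by rewrite /= ltr_norml; lra.
Unshelve. all: by end_near. Qed.

Lemma walk_cdf_gt0 al x : 0 < x -> 0 < fine (cdf (walk al) x).
Proof.
move=> x0; rewrite cdfE (eq_in_law_pr _ (walk_law al (fun=> 0))).
have [k kx] : exists k, edge R k < x.
  exists (Num.bound x^-1); rewrite /edge /low exprVn -[ltRHS]invrK.
  rewrite ltf_pV2 ?posrE ?invr_gt0 ?exprn_gt0//.
  by apply: upper_nthrootP; rewrite -addn2 leq_addr.
(* At phase 0 the loop [k] reaches its lower end at [U w / low R k = 3 / 2]. Moving on by [e] raises
   it by at most [2 * e], so it stays below [x]; [e <= 4^-1] keeps [U w] in the block. *)
pose e := Num.min ((x - edge R k) / 2) 4^-1.
have e0 : 0 < e by rewrite lt_min; move: kx; lra.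
have e1 : e <= (x - edge R k) / 2 by rewrite ge_min lexx.
have e2 : e <= 4^-1 by rewrite ge_min lexx orbT.
have l0 := low_gt0 R k; have l1 := low_le_half R k.
pose s := low R k * (3 / 2); pose t := low R k * (3 / 2 + e).
have st : s < t by rewrite ltr_pM2l// ltrDl.
have s0 : 0 <= s by rewrite mulr_ge0 ?ltW//; lra.
have t2 : t < 2 * low R k by rewrite /t [ltRHS]mulrC ltr_pM2l//; lra.
have : pr [set w | s <= U w <= t] <= pr [set w | walk (fun=> 0) w <= x].
  apply: le_pr; [exact: measurable_U_cc|exact: measurable_RV_le|].
  move=> w /= /andP[sU Ut].
  have bk : block (U w) = k.
    apply: block_unique; rewrite (le_lt_trans Ut t2) (le_trans _ sU)//.
    by rewrite ler_peMr ?ltW//; lra.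
  rewrite pos0E bk.
  have : 3 / 2 <= U w / low R k by rewrite ler_pdivlMr// mulrC.
  have : U w / low R k <= 3 / 2 + e by rewrite ler_pdivrMr// mulrC.
  set z := U w / _ => z1 z2.
  have := edge_bounds R k; set a := edge R k in kx e1 * => a0.
  rewrite ger0_norm; last by lra.
  have : (1 - 2 * a) * (2 * z - 3) <= 2 * z - 3 by rewrite ler_piMl//; lra.
  lra.
rewrite pr_U_cc//; [|exact: ltW|lra].
by move: st; lra.
Qed.

(** Half a turn reflects the walk, which reduces this to positivity at [(1 - x) / 2]; the halving
    makes the two events disjoint. *)
Lemma walk_cdf_lt1 al x : x < 1 -> fine (cdf (walk al) x) < 1.
Proof.
move=> x1; pose al' k : R := al k + 2^-1.
rewrite cdfE (eq_in_law_pr _ (walk_law al al')).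
have y0 : 0 < (1 - x) / 2 by lra.
have := walk_cdf_gt0 al y0; rewrite cdfE.
have mA : measurable [set w | walk al w <= (1 - x) / 2]
  by exact: measurable_RV_le.
have : pr [set w | walk al' w <= x] <= pr (~` [set w | walk al w <=
  (1 - x) / 2]).
  apply: le_pr; [exact: measurable_RV_le|exact: measurableC|].
  move=> w /=; rewrite pos_half; lra.
rewrite -setTD prDs// prT; lra.
Qed.

End LoopLaw.

(** * Domination and convergence of the averages *)

Section Gap.
Variables (R : realType) (C : R -> R -> R) (F : R -> R).
Hypothesis hC : copula C.
Hypothesis Cgap : forall p, 0 < p < 1 -> C p p < p.
Hypothesis cF : continuous F.
Hypothesis F01 : forall x, 0 < x < 1 -> 0 < F x < 1.

(** The points [y] and [z] vary independently, so that [z] can later be [y] minus a small shift. *)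
Lemma gap_local w0 : 0 < w0 < 1 -> exists2 r, 0 < r &
  forall y z, `|y - w0| < r -> `|z - w0| < r -> C (F y) (F y) <= F z.
Proof.
move=> w01; have gap := Cgap (F01 w01).
(* The estimate loses [2 * e] through [copula_diag_lip] and [e] through [F z], which a quarter of
   the gap allows; [e <= 1 - F w0] keeps the level [F w0 + e] at most 1. *)
pose e := Num.min ((F w0 - C (F w0) (F w0)) / 4)
  (Num.min (F w0) (1 - F w0)).
have Fw := F01 w01.
have e0 : 0 < e by rewrite !lt_min; lra.
have e1 : e <= (F w0 - C (F w0) (F w0)) / 4 by rewrite ge_min lexx.
have e2 : e <= 1 - F w0 by rewrite !ge_min lexx !orbT.
have /cvgrPdist_lt/(_ e e0)/nbhs_ballP[r /= r0 Fr] := cF (x := w0).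
exists r => // y z yr zr.
have Fy : `|F w0 - F y| < e by apply: Fr; rewrite /ball/= distrC.
have Fz : `|F w0 - F z| < e by apply: Fr; rewrite /ball/= distrC.
have : C (F w0 + e) (F w0 + e) <= C (F w0) (F w0) + 2 * (F w0 + e - F w0).
  by apply: copula_diag_lip => //; lra.
have : C (F y) (F y) <= C (F w0 + e) (F w0 + e).
  by apply: copula_mono => //; move: Fy; rewrite ltr_norml; lra.
by move: Fz; rewrite ltr_norml; lra.
Qed.

(** Compactness of [[a, 1 - a]] makes the radius of [gap_local] uniform. *)
Lemma gap_uniform (a : R) : 0 < a -> exists N : nat, forall n, (N <= n)%N ->
  forall w, a <= w <= 1 - a -> C (F w) (F w) <= F (w - 2 * n.+1%:R^-1).
Proof.
move=> a0.
have /compact_near_coveringP cov := @segment_compact R a (1 - a).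
have := cov nat \oo (fun n w => C (F w) (F w) <= F (w - 2 * n.+1%:R^-1)) _.
case.
  move=> w0 /=; rewrite in_itv/= => w0a.
  have [|r r0 Hr] := @gap_local w0; first by lra.
  have r2 : 0 < r / 2 by rewrite divr_gt0.
  have : \forall n \near \oo, n.+1%:R^-1 < r / 4 :> R.
    have r4 : 0 < r / 4 by rewrite divr_gt0.
    exact: (near_infty_natSinv_lt (PosNum r4)).
  (* The distance [r / 2] and the shift, less than [2 * (r / 4)], together stay below [r]. *)
  move=> hn; exists (ball w0 (r / 2), [set n | n.+1%:R^-1 < r / 4]).
    by split => //=; exact: nbhsx_ballx.
  move=> [y n] /= []; rewrite /ball/= => yr nr.
  have n0 : 0 < n.+1%:R^-1 :> R by rewrite invr_gt0.
  move: nr n0; set c := n.+1%:R^-1 => nr n0.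
  by apply: Hr; move: yr; rewrite !ltr_norml; lra.
move=> N _ HN; exists N => n Nn w wa; apply: (HN n Nn) => /=.
by rewrite in_itv.
Qed.

End Gap.

Section Dominance.
Context d (T : measurableType d) (R : realType) (P : probability T R).
Local Notation pr := (pr P).
Variables (C : R -> R -> R) (F : R -> R) (Y Z : T -> R) (K M : T -> nat).
Variable N : nat -> nat.
Hypotheses (mY : measurable_fun setT Y) (mZ : measurable_fun setT Z).
Hypothesis FY : forall x, pr [set w | Y w <= x] = F x.
Hypothesis HN : forall k w, edge R k <= w <= 1 - edge R k ->
  C (F w) (F w) <= F (w - 2 * (N k).+1%:R^-1).
Hypothesis Yitv : forall w, edge R (K w) <= Y w <= 1 - edge R (K w).
Hypothesis Zitv : forall w, edge R (K w) <= Z w <= 1 - edge R (K w).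
Hypothesis NM : forall w k, (k <= K w)%N -> ((N k).+1 <= M w)%N.
Hypothesis YZ : forall w, `|Y w - Z w| <= (M w)%:R^-1.

(* Only the loops [k] with [edge k <= z] and [w < 1 - edge k] can cross from
   below [z] to above [w]; the least such [k] bounds the step of all of them. *)
Lemma step_dominance z w : z <= w ->
  Num.min (F z) (C (F w) (F w)) <=
  pr ([set t | Y t <= z] `&` [set t | Z t <= w]).
Proof.
move=> zw.
have mYx x : measurable [set t | Y t <= x] by exact: measurable_set_le.
have mZx x : measurable [set t | Z t <= x] by exact: measurable_set_le.
pose crosses k := (edge R k <= z) && (w < 1 - edge R k).
have noncross t : Y t <= z -> ~~ crosses (K t) -> Z t <= w.
  move=> Yt; have := Yitv t; have := Zitv t;
    rewrite /crosses negb_and -ltNge -leNgt.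
  lra.
have full : (forall t, Y t <= z -> crosses (K t) -> Z t <= w) ->
    F z <= pr ([set t | Y t <= z] `&` [set t | Z t <= w]).
  move=> h; rewrite -FY; apply: le_pr => //; first exact: measurableI.
  move=> t /= Yt; split => //=.
  by have [|] := boolP (crosses (K t)); [exact: h|exact: noncross].
have [ex|nex] := pselect (exists k, crosses k); last first.
  rewrite ge_min; apply/orP; left; apply: full => t _ ct.
  by exfalso; apply: nex; exists (K t).
case: (ex_minnP ex) => k /andP[kz kw] kmin.
pose s : R := (N k).+1%:R^-1.
have s0 : 0 < s by rewrite invr_gt0.
have step t : crosses (K t) -> Z t <= Y t + s.
  move=> /kmin/NM kM.
  have : (M t)%:R^-1 <= s by rewrite lef_pV2 ?posrE ?ltr0n// ?ler_nat//;
    exact: leq_trans kM.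
  by have := YZ t; rewrite ler_norml; lra.
(* If [s <= w - z], no path gets from below [z] to above [w], and all of [F z] is kept. Otherwise a
   path with [Y t <= w - 2 * s] starts below [z] and ends below [w], and [HN] bounds the mass of
   these paths from below. *)
have [ws|ws] := leP s (w - z).
  rewrite ge_min; apply/orP; left; apply: full => t Yt /step; lra.
rewrite ge_min; apply/orP; right.
apply: le_trans (HN (k := k) _) _; first by lra.
rewrite -/s -FY; apply: le_pr => //; first exact: measurableI.
move=> t /= Yt; have Yz : Y t <= z by lra.
split => //=; have [/step|/(noncross t Yz)//] := boolP (crosses (K t)); lra.
Qed.

End Dominance.

(** * Averages of the loop walk *)

Section Assembly.
Context d (T : measurableType d) (R : realType) (P : probability T R).
Local Notation pr := (pr P).
Variable U : T -> R.
Hypothesis mU : measurable_fun setT U.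
Hypothesis U01 : forall w, 0 < U w < 1.
Hypothesis prU_le : forall x, 0 <= x <= 1 -> pr [set w | U w <= x] = x.
Variable M : nat -> nat.
Hypothesis M0 : forall k, (0 < M k)%N.
Hypothesis Mle : forall j k, (j <= k)%N -> (M j <= M k)%N.

Definition phase k : R := (2 * (M k)%:R)^-1.

Definition loop_walk n : {RV P >-> R} := walk P mU (fun k => n%:R * phase k).

Lemma phase_itv k : 0 <= phase k <= 2^-1.
Proof.
rewrite /phase invr_ge0 mulr_ge0//= lef_pV2 ?posrE ?mulr_gt0 ?ltr0n//.
by rewrite ler_peMr// ler1n.
Qed.

Lemma phaseM k : (M k)%:R * phase k = 2^-1.
Proof. by rewrite /phase; field; rewrite pnatr_eq0 -lt0n. Qed.

Lemma loop_walkS n w : loop_walk n.+1 w =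
  pos (fun k => n%:R * phase k + phase k) (U w).
Proof.
rewrite /= (_ : (fun k => _) = (fun k => n%:R * phase k + phase k))//.
by apply/funext => k; rewrite -natr1 mulrDl mul1r.
Qed.

Lemma loop_walk_step n w :
  `|loop_walk n.+1 w - loop_walk n w| <= (M (block (U w)))%:R^-1.
Proof.
rewrite loop_walkS (le_trans (pos_lip _ _ _))//; first exact: phase_itv.
by rewrite /phase invfM mulrA divff// mul1r.
Qed.

Lemma loop_walk_half n w :
  loop_walk (n + M (block (U w))) w = 1 - loop_walk n w.
Proof.
by rewrite walkE -pos_half /pos natrD [(n%:R + _) * _]mulrDl phaseM.
Qed.

(** Let [S n] be the sum. Cutting [S (n + m)] after [n] or after [m] terms and using [half], one
    gets [S n] plus a tail of [m] terms equal to [S m - S n]. So [2 * S n] is a difference of two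
    sums of [m] terms bounded by 1. *)
Lemma loop_walk_sum n w :
  `|\sum_(i < n) (loop_walk i w - 2^-1)| <= (M (block (U w)))%:R.
Proof.
set m := M _; pose y i := loop_walk i w - 2^-1.
have yb i : `|y i| <= 1.
  by have /= := walk_01 P mU (fun k => i%:R * phase k) w;
    rewrite /y ler_norml /=; lra.
have sb (j k : nat) : `|\sum_(j <= i < j + k) y i| <= k%:R.
  rewrite (le_trans (ler_norm_sum _ _ _))//.
  rewrite (le_trans (ler_sum _ (fun i _ => yb i)))//.
  by rewrite sumr_const_nat addKn.
have half i : y (i + m)%N = - y i by rewrite /y loop_walk_half; lra.
rewrite -(big_mkord xpredT y).
have e1 : \sum_(0 <= i < n + m) y i = \sum_(0 <= i < n) y i +
  \sum_(n <= i < n + m) y i.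
  by rewrite -big_cat_nat// leq_addr.
have e2 : \sum_(0 <= i < m + n) y i =
  \sum_(0 <= i < m) y i - \sum_(0 <= i < n) y i.
  rewrite (@big_cat_nat _ _ _ m)//= ?leq_addr//; congr (_ + _).
  rewrite -{1}[m]add0n big_addn addKn -sumrN; apply: eq_bigr => i _.
  exact: half.
have := sb n m; have := sb 0%N m; rewrite add0n.
move: e1 e2; rewrite addnC => -> e2; rewrite !ler_norml; lra.
Qed.

(** Off the event [U w < low R J], of mass [low R J], the block index is at most [J], and the
    centred sums are bounded by [M J] uniformly in [w]. *)
Lemma loop_walk_cvg : cvg_in_probability P (centered_average loop_walk) 0.
Proof.
move=> e e0.
have mean0 : fine (expectation P (loop_walk 0)) = 2^-1 by rewrite walk_mean.
have avg n w : centered_average loop_walk n w =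
    n.+1%:R^-1 * (\sum_(i < n.+1) (loop_walk i w - 2^-1)).
  rewrite /centered_average mean0 sumrB sumr_const card_ord mulrBr;
    congr (_ - _).
  by rewrite -[2^-1 *+ _]mulr_natl mulrA mulVf ?mul1r.
have mbad n : measurable [set w | e < `|centered_average loop_walk n w - 0|].
  rewrite (_ : mkset _ = ~` [set w | `|centered_average loop_walk n w| <= e]).
    apply: measurableC; apply: measurable_set_le; apply: measurableT_comp => //.
    apply: measurable_funB => //; apply: measurable_funM => //.
    exact: measurable_sum.
  by apply/seteqP; split => w /=; rewrite subr0 ltNge => /negP.
apply/cvg_EFin; first by apply: nearW => n; rewrite fin_num_measure.
apply/cvgrPdist_le => eta eta0.
have [J Jeta] : exists J, low R J <= eta.
  exists (Num.bound eta^-1); rewrite /low exprVn -[leRHS]invrK.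
  rewrite lef_pV2 ?posrE ?invr_gt0 ?exprn_gt0//.
  by apply: ltW; apply: upper_nthrootP.
exists (Num.bound ((M J)%:R / e)) => // n /= nJ.
rewrite sub0r normrN ger0_norm ?fine_ge0// (le_trans _ Jeta)//.
have l1 := low_le_half R J; have l0 := low_gt0 R J.
rewrite -[leRHS](pr_U_lt mU prU_le); last by lra.
apply: le_pr => //; first exact: measurable_set_lt.
move=> w /=; rewrite subr0 avg => bad.
rewrite ltNge; apply/negP => JU.
have bJ : (block (U w) <= J)%N.
  rewrite leqNgt; apply/negP => /(low_lt R).
  have := blockP (U01 w); lra.
have := loop_walk_sum n.+1 w; move: bad; set S := \sum_(i < _) _ => bad Sle.
have : (M J)%:R / e < n.+1%:R.
  rewrite (lt_le_trans (ltr_bound _))// ler_nat.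
  exact: leqW.
rewrite ltr_pdivrMr// => h; move: bad; rewrite ltNge => /negP; apply.
rewrite normrM ger0_norm ?invr_ge0// mulrC ler_pdivrMr// mulrC.
rewrite (le_trans Sle)// (le_trans _ (ltW h))// ler_nat; exact: Mle.
Qed.

End Assembly.

Section Diversifiable.
Context d (T : measurableType d) (R : realType) (P : probability T R).
Hypothesis hP : atomless P.
Local Notation pr := (pr P).

Lemma diversifiable_copula_above (C : R -> R -> R) : copula C ->
  (forall p, 0 < p < 1 -> C p p < p) ->
  exists C', [/\ copula C', copula_le C C' & ~ non_diversifiable P C'].
Proof.
move=> hC Cgap; have [U [mU U01 prU_le]] := atomless_uniform hP.
(* Phase 0 defines [F] before any period is chosen; every walk has this law. *)
pose W := walk P mU (fun=> 0).
pose F x := fine (cdf W x).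
have cW : continuous (cdf W) by exact: walk_cdf_continuous.
have law al x : pr [set w | walk P mU al w <= x] = F x.
  rewrite /F cdfE; apply: eq_in_law_pr; exact: walk_law.
have F01 x : 0 < x < 1 -> 0 < F x < 1.
  by move=> /andP[x0 x1]; rewrite walk_cdf_gt0//= walk_cdf_lt1.
have /choice[N HN] k : exists N : nat, forall n, (N <= n)%N ->
    forall w, edge R k <= w <= 1 - edge R k ->
    C (F w) (F w) <= F (w - 2 * n.+1%:R^-1).
  apply: gap_uniform => //; first exact: continuous_fine_cdf.
  by have /andP[] := edge_bounds R k.
(* The sum is monotone in [k] and dominates each [N j] with [j <= k]; the successor gives positivity
   and [(N j).+1 <= M k]. *)
pose M k := (\sum_(j < k.+1) N j).+1.
have M0 k : (0 < M k)%N by [].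
have Mle j k : (j <= k)%N -> (M j <= M k)%N.
  move=> jk; rewrite /M ltnS -!(big_mkord xpredT N).
  by rewrite (@big_cat_nat _ _ _ j.+1 0%N k.+1)//= leq_addr.
have NM j k : (j <= k)%N -> (N j < M k)%N.
  move=> /Mle; apply: leq_trans; rewrite /M ltnS big_ord_recr /= leq_addl//.
pose X := loop_walk P mU M.
have XL n : in_Linfty_c (X n).
  by split; [exact: walk_Linfty|exact: walk_cdf_continuous].
have Xlaw n : eq_in_law (X n) (X n.+1) by exact: walk_law.
have Xcdf n : cdf (X n) = cdf W.
  by apply/funext => x; apply: walk_law.
(* The copula is taken from the first pair; stationarity, in [pair], carries it over to all
   consecutive pairs. *)
have [C' [hC' C'E]] := copula_exists (XL 0%N).2 (Xlaw 0%N).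
have pair n x y : pr ([set w | X n w <= x] `&` [set w | X n.+1 w <= y]) =
    pr ([set w | pos (fun=> 0) (U w) <= x]
      `&` [set w | pos (phase R M) (U w) <= y]).
  rewrite -(pos_law2 mU U01 prU_le (fun k => n%:R * phase R M k)).
  congr (pr (_ `&` _)); apply/funext => w; rewrite /mkset /X.
  by rewrite loop_walkS.
have Xpair n x y : pr ([set w | X n w <= x] `&` [set w | X n.+1 w <= y]) =
    C' (F x) (F y).
  rewrite pair -(pair 0%N); apply: EFin_inj.
  rewrite /F -{1}(Xcdf 0%N) -(Xcdf 1%N) -C'E -prE; first by congr (P _).
  by apply: measurableI; exact: measurable_RV_le.
exists C'; split => //.
  apply: copula_le_interior => // u v u01 v01.
  have [x Fx] : exists x, F x = u by exact: cdf_surj.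
  have [y Fy] : exists y, F y = v by exact: cdf_surj.
  rewrite -Fx -Fy -(Xpair 0%N).
  have Xstep w : `|X 0%N w - X 1%N w| <= (M (block (U w)))%:R^-1.
    by rewrite distrC; exact: loop_walk_step.
  have [xy|yx] := leP x y.
    apply: le_trans (step_dominance (C := C) (F := F) (Y := X 0%N) (Z := X 1%N)
      (K := fun w => block (U w)) (M := fun w => M (block (U w))) (N := N)
      _ _ _ _ _ _ _ _ xy) => //.
    + rewrite le_min; apply/andP; split.
        by apply: copula_le1 => //; exact: fine_cdf_bounds.
      by apply: copula_mono => //; exact: fine_cdf_mono.
    + by move=> z; exact: law.
    + by move=> k w; exact: HN.
    + by move=> w; exact: pos_itv.
    + by move=> w; exact: pos_itv.
    + by move=> w k; exact: NM.
  (* For [y < x] the two times exchange roles; the bound on the step is symmetric. *)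
  rewrite setIC.
  apply: le_trans (step_dominance (C := C) (F := F) (Y := X 1%N) (Z := X 0%N)
    (K := fun w => block (U w)) (M := fun w => M (block (U w))) (N := N)
    _ _ _ _ _ _ _ _ (ltW yx)) => //.
  + rewrite le_min; apply/andP; split.
      by apply: copula_le2 => //; exact: fine_cdf_bounds.
    by apply: copula_mono => //; exact: fine_cdf_mono (ltW yx).
  + by move=> z; exact: law.
  + by move=> k w; exact: HN.
  + by move=> w; exact: pos_itv.
  + by move=> w; exact: pos_itv.
  + by move=> w k; exact: NM.
  + by move=> w; rewrite distrC.
move=> /(_ X); apply; last exact: loop_walk_cvg.
split=> [//|n]; split => //; split => // x y.
rewrite !Xcdf -/(F x) -/(F y) -(Xpair n) -prE; first by congr (P _).
by apply: measurableI; exact: measurable_RV_le.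
Qed.

End Diversifiable.

Theorem theorem5 (d : measure_display) (T : measurableType d) (R : realType)
    (P : probability T R) (hP : atomless P) (C : R -> R -> R)
    (hC : copula C) :
  (exists D : set (R -> R -> R), concentration_class P D /\ D C) <->
  (exists p : R, [/\ 0 < p, p < 1 & diagonal_class p C]).
Proof.
split=> [[D [hD DC]]|[p [p0 p1 DpC]]]; last first.
  exists (diagonal_class p); split => //.
  by apply: diagonal_class_concentration; rewrite p0.
apply: contrapT => nC.
have Cgap p : 0 < p < 1 -> C p p < p.
  move=> /andP[p0 p1]; rewrite lt_neqAle copula_le1 ?ltW ?p0// andbT.
  by apply/eqP => Cp; apply: nC; exists p.
have [C' [hC' CC' nD]] := diversifiable_copula_above hP hC Cgap.
(* By [concentration_DM] the larger copula [C'] lies in [D] as well, although it is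
   diversifiable. *)
apply: nD; apply: (concentration_ND hD).
exact: (concentration_DM hD DC).
Qed.
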